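(* For every $(N,M,L)\in U_3$, $$C(N,M,L)^4=(-1)^{d\cdot n}\cdot|M|^2.$$
   Context: Let $K$ be an unramified extension of $\mathbb{Q}_2$ of degree $d$, $\mathcal{O}_K$ its ring of integers, $\mathfrak{m}_K=2\mathcal{O}_K$, $k=\mathcal{O}_K/\mathfrak{m}_K=\mathbb{F}_{2^d}$, $R=\mathcal{O}_K/\mathfrak{m}_K^2$, $tr:R\to\mathbb{Z}/4$ the trace, $\psi(z)=e^{\frac{2\pi i}{4}tr(z)}$ for $z\in R$. Let $(\widetilde{V},\widetilde{\omega})$ be a free symplectic $R$-module of rank $2n$, $V=\widetilde{V}/2\widetilde{V}$. The form $2\widetilde{\omega}$ factors to a non-degenerate skew-symmetric form $\omega:V\times V\to R$. Fix a splitting $\widetilde{V}=\widetilde{L}_0\times\widetilde{M}_0$ into free Lagrangian submodules; put $\widetilde{\beta}((l_1,m_1),(l_2,m_2))=\widetilde{\omega}(l_1,m_2)$; $2\widetilde{\beta}$ factors to $\beta:V\times V\to R$. The Heisenberg group is $H(V)=V\times R$ with $(v_1,z_1)(v_2,z_2)=(v_1+v_2,z_1+z_2+\beta(v_1,v_2))$, with center $Z=\{0\}\times R$. $ELag(V)$ is the set of enhanced Lagrangians: group homomorphisms $\tau:L\to H(V)$ that are sections of $H(V)\to V$ over a Lagrangian subspace $L\subset V$; such $\tau$ is denoted simply $L$. For $L\in ELag(V)$, $\mathcal{H}_L$ is the space of functions $f:H(V)\to\mathbb{C}$ with $f(z\tau(l)h)=\psi(z)f(h)$ for $z\in Z$,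 $l\in L$, with $H(V)$ acting by right translations; it is irreducible. For $(M,L)\in ELag(V)^2$ in general position ($M+L=V$), $F_{M,L}:\mathcal{H}_L\to\mathcal{H}_M$ is the intertwiner $F_{M,L}[f](h)=\sum_{m\in M}f(\tau(m)h)$, $\tau:M\to H(V)$ being the enhanced Lagrangian $M$. $U_3\subset ELag(V)^3$ is the set of triples $(N,M,L)$ pairwise in general position. For $(N,M,L)\in U_3$, $C(N,M,L)\in\mathbb{C}$ is the proportionality constant defined by $F_{N,M}\circ F_{M,L}=C(N,M,L)\cdot F_{N,L}$. *)

(* Defs.v *)
From HB Require Import structures.
From mathcomp Require Import all_boot all_order all_algebra all_field.
From mathcomp Require Import zify.
From mathcomp Require Import complex.
From mathcomp Require Import generic_quotient ring_quotient finmap.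
From mathcomp Require Import boolp classical_sets functions cardinality fsbigop.
From mathcomp Require Import reals trigo.

Set Implicit Arguments.
Unset Strict Implicit.
Unset Printing Implicit Defensive.

Import Order.TTheory GRing.Theory Num.Theory.
Local Open Scope classical_set_scope.
Local Open Scope quotient_scope.
Local Open Scope ring_scope.

(* Z_2 is the inverse limit of the rings Z/2^m; the component in Z/2^m is
   stored as its representative in [0, 2^m), which is what the equation
   below enforces. *)
Definition coherent (x : nat -> int) : bool :=
  `[< forall m, x m = (x m.+1 %% 2 ^+ m)%Z >].

Record Z2 := MkZ2 { z2val :> nat -> int; z2P : coherent z2val }.
HB.instance Definition _ := [isSub for z2val].
HB.instance Definition _ := [Choice of Z2 by <:].

Section Z2Ring.

Lemma z2_eq (x y : Z2) : (forall m, x m = y m) -> x = y.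
Proof. by move=> xy; apply: val_inj; apply: funext. Qed.

Lemma z2S (x : Z2) m : x m = (x m.+1 %% 2 ^+ m)%Z.
Proof. by have /asboolP := z2P x; apply. Qed.

Lemma z2mod (x : Z2) m : (x m %% 2 ^+ m)%Z = x m.
Proof. by rewrite z2S modz_mod. Qed.

Lemma modz_dvdm (d e a : int) : (d %| e)%Z -> ((a %% e)%Z %% d)%Z = (a %% d)%Z.
Proof.
by case/dvdzP => q ->; rewrite [in RHS](divz_eq a (q * d)) mulrA modzMDl.
Qed.

Lemma modz_pow2S (a : int) m : ((a %% 2 ^+ m.+1)%Z %% 2 ^+ m)%Z = (a %% 2 ^+ m)%Z.
Proof. by rewrite modz_dvdm // exprS dvdz_mull. Qed.

Lemma z2_coherent (f : nat -> int) :
  (forall m, (f m.+1 = f m %[mod 2 ^+ m])%Z) ->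
  coherent (fun m => (f m %% 2 ^+ m)%Z).
Proof. by move=> fS; apply/asboolP => m; rewrite modz_pow2S fS. Qed.

Lemma z2addP (x y : Z2) m :
  (x m.+1 + y m.+1 = x m + y m %[mod 2 ^+ m])%Z.
Proof. by rewrite [x m]z2S [y m]z2S modzDm. Qed.

Lemma z2mulP (x y : Z2) m :
  (x m.+1 * y m.+1 = x m * y m %[mod 2 ^+ m])%Z.
Proof. by rewrite [x m]z2S [y m]z2S modzMm. Qed.

Lemma z2oppP (x : Z2) m : (- x m.+1 = - x m %[mod 2 ^+ m])%Z.
Proof. by rewrite [x m]z2S modzNm. Qed.

Lemma z2intP (n : int) m : (n = n %[mod 2 ^+ m])%Z.
Proof. by []. Qed.

Definition z2int (n : int) : Z2 := MkZ2 (z2_coherent (z2intP n)).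
Definition z2add (x y : Z2) : Z2 := MkZ2 (z2_coherent (z2addP x y)).
Definition z2mul (x y : Z2) : Z2 := MkZ2 (z2_coherent (z2mulP x y)).
Definition z2opp (x : Z2) : Z2 := MkZ2 (z2_coherent (z2oppP x)).

Lemma z2addA : associative z2add.
Proof. by move=> x y z; apply: z2_eq => m /=; rewrite modzDml modzDmr addrA. Qed.
Lemma z2addC : commutative z2add.
Proof. by move=> x y; apply: z2_eq => m /=; rewrite addrC. Qed.
Lemma z2add0 : left_id (z2int 0) z2add.
Proof. by move=> x; apply: z2_eq => m /=; rewrite mod0z add0r z2mod. Qed.
Lemma z2addN : left_inverse (z2int 0) z2opp z2add.
Proof. by move=> x; apply: z2_eq => m /=; rewrite modzDml addNr. Qed.
Lemma z2mulA : associative z2mul.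
Proof. by move=> x y z; apply: z2_eq => m /=; rewrite modzMml modzMmr mulrA. Qed.
Lemma z2mulC : commutative z2mul.
Proof. by move=> x y; apply: z2_eq => m /=; rewrite mulrC. Qed.
Lemma z2mul1 : left_id (z2int 1) z2mul.
Proof. by move=> x; apply: z2_eq => m /=; rewrite modzMml mul1r z2mod. Qed.
Lemma z2mulDl : left_distributive z2mul z2add.
Proof.
by move=> x y z; apply: z2_eq => m /=; rewrite modzMml modzDmr modzDml mulrDl.
Qed.
Lemma z2one_neq0 : z2int 1 != z2int 0.
Proof. by apply/eqP => /(congr1 (fun x : Z2 => x 1%N)). Qed.

HB.instance Definition _ :=
  GRing.isZmodule.Build Z2 z2addA z2addC z2add0 z2addN.
HB.instance Definition _ :=
  GRing.Zmodule_isComNzRing.Build Z2 z2mulA z2mulC z2mul1 z2mulDl z2one_neq0.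

Definition z2unit : pred Z2 := fun x => `[< exists y : Z2, y * x = 1 >].
Definition z2inv (x : Z2) : Z2 :=
  if z2unit x then xget 0 [set y : Z2 | y * x = 1] else x.

Lemma z2mulVx : {in z2unit, left_inverse 1 z2inv *%R}.
Proof.
move=> x; rewrite -topredE /= => ux; rewrite /z2inv ux.
by move: ux => /asboolP ux; apply: (xgetPex 0 ux).
Qed.
Lemma z2unitPl (x y : Z2) : y * x = 1 -> z2unit x.
Proof. by move=> yx; apply/asboolP; exists y. Qed.
Lemma z2inv_out : {in [predC z2unit], z2inv =1 id}.
Proof. by move=> x; rewrite inE /= /z2inv -topredE /= => /negbTE ->. Qed.

HB.instance Definition _ :=
  GRing.ComNzRing_hasMulInverse.Build Z2 z2mulVx z2unitPl z2inv_out.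

Lemma z2mod_le (x : Z2) m k : (x (k + m)%N = x m %[mod 2 ^+ m])%Z.
Proof.
elim: k => [//|k IH]; rewrite addSn -{}IH [x (k + m)%N]z2S.
by rewrite (@modz_dvdm _ (2 ^+ (k + m))) // exprD dvdz_mull.
Qed.

Lemma z2val0 m : (0 : Z2) m = 0.
Proof. by rewrite /= mod0z. Qed.

Lemma z2neq0 (x : Z2) : x != 0 -> exists m, forall k, ~~ (2 ^+ m %| x (k + m)%N)%Z.
Proof.
move=> x0; have [m xm] : exists m, x m <> 0.
  apply: contrapT => /forallNP H; move/eqP: x0; apply; apply: z2_eq => m.
  by rewrite z2val0; apply: contrapT; apply: H.
exists m => k; apply/negP => /dvdz_mod0P.
by rewrite z2mod_le z2mod => /xm.
Qed.

Lemma z2_idomain (x y : Z2) : x * y = 0 -> (x == 0) || (y == 0).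
Proof.
move=> xy; case: (eqVneq x 0) => //= /z2neq0 [m xm].
case: (eqVneq y 0) => //= /z2neq0 [n yn].
have {}xm := xm n; have {}yn := yn m; rewrite addnC in xm.
have := congr1 (fun z : Z2 => z (m + n)%N) xy; rewrite z2val0 /=.
move/dvdz_mod0P; move: xm yn.
set a := (x : nat -> int) _; set b := (y : nat -> int) _.
rewrite !dvdzE abszM !abszX /= => am bn ab.
have a0 : (0 < `|a|)%N by rewrite lt0n; apply: contraNneq am => ->; rewrite dvdn0.
have b0 : (0 < `|b|)%N by rewrite lt0n; apply: contraNneq bn => ->; rewrite dvdn0.
move: am bn ab; rewrite !pfactor_dvdn ?muln_gt0 ?a0 // lognM //.
rewrite -!ltnNge; lia.
Qed.

HB.instance Definition _ := GRing.ComUnitRing_isIntegral.Build Z2 z2_idomain.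

End Z2Ring.

Notation Q2 := {fraction Z2}.

Definition z2_mod4 (z : Z2) : 'Z_4 := (z 2%N)%:~R.

Section Integers.
Variable K : fieldExtType Q2.

Definition Z2inK : {rmorphism Z2 -> K} := (in_alg K \o @tofrac Z2)%FUN.

Definition integral_closure : pred K := fun x => `[< integralOver Z2inK x >].

Lemma integral_closure_subring : subring_closed integral_closure.
Proof.
split.
- by apply/asboolP; exact: integral1.
- move=> x y /asboolP xi /asboolP yi; apply/asboolP; exact: integral_sub.
- move=> x y /asboolP xi /asboolP yi; apply/asboolP; exact: integral_mul.
Qed.
HB.instance Definition _ :=
  GRing.isSubringClosed.Build K integral_closure integral_closure_subring.

Record OK := MkOK { OKval :> K; OKP : integral_closure OKval }.
HB.instance Definition _ := [isSub for OKval].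
HB.instance Definition _ := [Choice of OK by <:].
HB.instance Definition _ := [SubChoice_isSubComNzRing of OK by <:].

(* m_K = 2 O_K, where m_K is the set of non-units of the local ring O_K. *)
Definition unramified : Prop :=
  forall x : OK, (~ exists y : OK, x * y = 1) <-> (exists y : OK, x = 2 * y).

(* trace of multiplication by x on the Q_2-vector space K *)
Definition field_trace (x : K) : Q2 :=
  \tr (passmx.mxof (vbasis {:K}) (vbasis {:K}) (amulr x)).

(* 2^(e+1) O_K, which is m_K^(e+1) when K is unramified *)
Definition mpow (e : nat) : pred OK :=
  fun x => `[< exists y : OK, x = 2 ^+ e.+1 * y >].

Lemma OK_not_half (y : OK) : 1 <> 2 * y.
Proof.
move=> y2; have /asboolP [p pmon /rootP py0] := OKP y.
have {}y2 : 1 = 2 * (y : K) by rewrite {1}[1](congr1 OKval y2).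
have sp : (0 < size p)%N by rewrite size_poly_gt0 monic_neq0.
pose n := (size p).-1; have nE : size p = n.+1 by rewrite prednK.
pose s : Z2 := 1 + 2 * \sum_(i < n) p`_i * 2 ^+ (n.-1 - i).
suff s0 : s = 0.
  have := congr1 (fun z : Z2 => z 1%N) s0; rewrite z2val0.
  rewrite /s mulrDl mul1r /= !modzDml !modzDmr.
  move: (\sum_(i < n) _) => t /=; lia.
suff : Z2inK s = 0 by move/eqP; rewrite fmorph_eq0 tofrac_eq0 => /eqP.
move: Z2inK py0 => f /(congr1 ( *%R (2 ^+ n))); rewrite mulr0 => <-.
rewrite horner_coef size_map_poly_id0; last first.
  by rewrite (monicP pmon) rmorph1 oner_neq0.
rewrite nE big_ord_recr /= !coef_map /= -[p`_n]/(lead_coef p) (monicP pmon).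
rewrite rmorph1 mul1r mulrDr -exprMn -y2 expr1n /s rmorphD rmorphM rmorph1.
rewrite rmorph_nat rmorph_sum /= addrC !mulr_sumr; congr (_ + _).
apply: eq_bigr => i _; rewrite coef_map /= rmorphM rmorphXn rmorph_nat.
rewrite mulrCA [RHS]mulrCA; congr (_ * _); set k := (n.-1 - i)%N.
have nk : n = (k.+1 + i)%N by have := ltn_ord i; lia.
by rewrite [X in 2 ^+ X * _]nk exprD -mulrA -exprMn -y2 expr1n mulr1 exprS.
Qed.

Lemma mpow_idealr e : idealr_closed (mpow e).
Proof.
split.
- by apply/asboolP; exists 0; rewrite mulr0.
- apply/negP => /asboolP [y]; rewrite exprS -mulrA; exact: OK_not_half.
- move=> a x y /asboolP [x' ->] /asboolP [y' ->]; apply/asboolP.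
  by exists (a * x' + y'); rewrite mulrDr mulrCA.
Qed.
HB.instance Definition _ e := isIdealr.Build OK (mpow e) (mpow_idealr e).


Definition mK_powS e : idealr OK := mpow e.
End Integers.

Notation residue_field K := {ideal_quot (mK_powS K 0)}.
Notation RK K := {ideal_quot (mK_powS K 1)}.


(* The map induced on O_K/m_K^2 -> Z_2/4 by the trace of K/Q_2, which maps
   O_K to Z_2; the default value of xget is never used. *)
Definition tr (K : fieldExtType Q2) (r : RK K) : 'Z_4 :=
  xget 0 [set t | exists (x : OK K) (z : Z2),
    [/\ \pi_(RK K) x = r, field_trace x = tofrac z & t = z2_mod4 z]].

Section Reduction.
Variables (K : fieldExtType Q2) (Vt : lmodType (RK K)).

Definition double_mod : pred Vt := fun v => `[< exists w, v = 2 *: w >].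

Lemma double_mod_closed : zmod_closed double_mod.
Proof.
split; first by apply/asboolP; exists 0; rewrite scaler0.
move=> x y /asboolP [x' ->] /asboolP [y' ->]; apply/asboolP.
by exists (x' - y'); rewrite scalerBr.
Qed.
HB.instance Definition _ := GRing.isZmodClosed.Build Vt double_mod double_mod_closed.

Definition double_submod := GRing.ZmodClosed.clone Vt double_mod _.
(* V = Vt / 2 Vt, a vector space over k = O_K / 2 O_K *)
Definition reduction : Type := Quotient.quot double_submod.
HB.instance Definition _ := GRing.Zmodule.on reduction.
HB.instance Definition _ := Quotient.on reduction.

Definition red_scale (c : residue_field K) (v : reduction) : reduction :=
  \pi_reduction (\pi_(RK K) (repr c) *: repr v).

Lemma red_eqP (v w : Vt) :
  (exists u, v - w = 2 *: u) -> \pi_reduction v = \pi_reduction w.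
Proof.
by move=> vw; apply/eqP; rewrite -Quotient.idealrBE; apply/asboolP.
Qed.
Lemma red_eq_inv (v w : Vt) :
  \pi_reduction v = \pi_reduction w -> exists u, v - w = 2 *: u.
Proof. by move/eqP; rewrite -Quotient.idealrBE => /asboolP. Qed.

Lemma red_scaleE (x : OK K) (v : Vt) :
  red_scale (\pi_(residue_field K) x) (\pi_reduction v) =
  \pi_reduction (\pi_(RK K) x *: v).
Proof.
have /eqP : \pi_(residue_field K) (repr (\pi_(residue_field K) x)) =
  \pi_(residue_field K) x by rewrite reprK.
rewrite -Quotient.idealrBE => /asboolP [z xz].
have [u vu] : exists u, repr (\pi_reduction v) - v = 2 *: u.
  by apply: red_eq_inv; rewrite reprK.
rewrite /red_scale; move: (repr _) (repr _) xz vu => w y yz wu.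
apply: red_eqP; exists (\pi_(RK K) y *: u + \pi_(RK K) z *: v).
rewrite scalerDr [2 *: (_ *: u)]scalerA mulrC -scalerA -wu scalerA.
have -> : 2 * \pi_(RK K) z = \pi_(RK K) y - \pi_(RK K) x.
  by rewrite -rmorphB yz expr1 rmorphM rmorph_nat.
by rewrite scalerBl scalerBr addrA subrK.
Qed.

Lemma red_scaleA (a b : residue_field K) (v : reduction) :
  red_scale a (red_scale b v) = red_scale (a * b) v.
Proof.
rewrite -[a]reprK -[b]reprK -[v]reprK -rmorphM.
by rewrite [X in red_scale _ X]red_scaleE !red_scaleE rmorphM scalerA.
Qed.
Lemma red_scale1 : left_id 1 red_scale.
Proof.
by move=> v; rewrite -[v]reprK -[1](rmorph1 \pi_(residue_field K)) red_scaleE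
  rmorph1 scale1r.
Qed.
Lemma red_scaleDr : right_distributive red_scale +%R.
Proof.
move=> a v w; rewrite -[a]reprK -[v]reprK -[w]reprK -[_ + _]raddfD.
by rewrite !red_scaleE scalerDr -[RHS]raddfD.
Qed.
Lemma red_scaleDl v : {morph red_scale^~ v : a b / a + b}.
Proof.
move=> a b /=; rewrite -[a]reprK -[b]reprK -[v]reprK -rmorphD.
by rewrite !red_scaleE rmorphD scalerDl -[RHS]raddfD.
Qed.
HB.instance Definition _ := GRing.Zmodule_isLmodule.Build (residue_field K)
  reduction red_scaleA red_scale1 red_scaleDr red_scaleDl.

End Reduction.

Arguments reduction {K} Vt.

Section Lagrangian.
Variables (S : nzRingType) (W : lmodType S) (A : zmodType) (form : W -> W -> A).

Definition submodule (L : set W) : Prop :=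
  L 0 /\ forall (a : S) v w, L v -> L w -> L (a *: v + w).

Definition lagrangian (L : set W) : Prop :=
  submodule L /\ forall v, L v <-> (forall w, L w -> form v w = 0).

End Lagrangian.

Definition free_submodule (S : nzRingType) (W : lmodType S) (L : set W) : Prop :=
  exists m (f : {linear 'rV[S]_m -> W}), injective f /\ range f = L.

Section Heisenberg.
Variables (Rr : realType) (K : fieldExtType Q2) (Vt : vectType (RK K)).
Variables (omt : {biscalar Vt}) (L0 M0 : set Vt).

(* Vt being finite, this is the same as asking Vt -> Hom(Vt, R) to be bijective. *)
Definition symplectic : Prop :=
  (forall v, omt v v = 0) /\ (forall v, (forall w, omt v w = 0) -> v = 0).

Definition lagrangian_splitting : Prop :=
  [/\ lagrangian omt L0, lagrangian omt M0, free_submodule L0, free_submodule M0 &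
    forall v, exists! lm : Vt * Vt, [/\ L0 lm.1, M0 lm.2 & v = lm.1 + lm.2]].

Definition components (v : Vt) : Vt * Vt :=
  xget (0, 0) [set lm | [/\ L0 lm.1, M0 lm.2 & v = lm.1 + lm.2]].

(* beta((l1, m1), (l2, m2)) = omega(l1, m2) *)
Definition betat (v w : Vt) : RK K := omt (components v).1 (components w).2.

Local Notation V := (reduction Vt).

(* Both factor through V, so the choice of representatives is irrelevant. *)
Definition omega (v w : V) : RK K := 2 * omt (repr v) (repr w).
Definition beta (v w : V) : RK K := 2 * betat (repr v) (repr w).

Definition heis : Type := (V * RK K)%type.
Definition hmul (g h : heis) : heis := (g.1 + h.1, g.2 + h.2 + beta g.1 h.1).

(* [esec] is only relevant on [esupp]. *)
Record elag : Type := Elag {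
  esupp : set V;
  esec : V -> heis;
  esupp_lagrangian : lagrangian omega esupp;
  esec_section : forall l, esupp l -> (esec l).1 = l;
  esec_morph : forall l l', esupp l -> esupp l' ->
    esec (l + l') = hmul (esec l) (esec l') }.

(* e^(ix) *)
Definition expi (x : Rr) : Rr[i] := (cos x +i* sin x)%C.
Definition psi (z : RK K) : Rr[i] := expi (2 * pi / 4 * (tr z : nat)%:R).

Definition Hspace (L : elag) : set (heis -> Rr[i]) :=
  [set f | forall z l h, esupp L l ->
    f (hmul (hmul (0, z) (esec L l)) h) = psi z * f h].

(* F_{M,L}: its formula depends on L only through its domain H_L. Since V is
   finite, this is a genuine sum over all the elements of M. *)
Definition intertwiner (M : elag) (f : heis -> Rr[i]) : heis -> Rr[i] :=
  fun h => \sum_(m \in esupp M) f (hmul (esec M m) h).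

Definition general_position (M L : elag) : Prop :=
  forall v, exists m l, [/\ esupp M m, esupp L l & v = m + l].

Definition U3 (N M L : elag) : Prop :=
  [/\ general_position N M, general_position M L & general_position N L].

(* The c such that F_{N,M} \o F_{M,L} = c F_{N,L} on H_L (0 if there were none). *)
Definition Cconst (N M L : elag) : Rr[i] :=
  xget 0 [set c | forall f, Hspace L f ->
    intertwiner N (intertwiner M f) = (fun h => c * intertwiner N f h)].

End Heisenberg.

(* Main.v *)
Require Import Defs.
From HB Require Import structures.
From mathcomp Require Import all_boot all_order all_algebra all_fingroup.
From mathcomp Require Import all_solvable all_field.
From mathcomp Require Import zify ring lra.
From mathcomp Require Import complex finmap generic_quotient ring_quotient.
From mathcomp Require Import boolp classical_sets functions cardinality fsbigop.
From mathcomp Require Import reals trigo.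

(** Why the theorem is true.  Let [m] run over the Lagrangian [M] and split it
    as [m = n + l] along [N] and [L].  In the Heisenberg group the section over
    [M] at [m] is the product of the sections over [L] at [l] and over [N] at
    [n], up to a central element [chi m].  A function in H_L turns this central
    element into the scalar [psi (chi m)], and the section over [N] is absorbed
    by the sum over [N]; so the composite of the two intertwiners is the third
    one times the Gauss sum of [psi (chi m)] over [M] ([CconstE]).

    The function [chi] is quadratic, with polar form sending [y] and [z] to
    [omega y l], where [l] is the component of [z] along [L] ([chiD]).  This
    form is non-degenerate on [M] because the three Lagrangians are in general
    position, so orthogonality of characters gives the norm of the Gauss sum:
    it is the cardinality of [M], which is [2 ^ (d * n)].

    The values of [psi] are fourth roots of unity, so the Gauss sum is a
    Gaussian integer [a + i b] with [a ^+ 2 + b ^+ 2 = 2 ^+ (d * n)].  The prime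
    2 ramifies in the Gaussian integers: up to a unit the only element of norm
    [2 ^+ D] is the [D]-th power of [1 + i], whose fourth power is [(-4) ^+ D].
    Fourth powers do not see units, so this gives the theorem
    ([gaussian_norm_pow2]).

    The arithmetic of [K] enters twice.  First, [O_K] is free of rank [d] over
    the two-adic integers, on any lift of a basis of the residue field
    ([exists_integral_basis]); this gives the cardinality of the residue field,
    and shows that the trace modulo 4 is a sum of coordinates.  Second, the
    non-degeneracy above needs [psi] to be non-trivial on the multiples of 2,
    that is, some element of [O_K] must have an odd trace.  This is a statement
    on the residue field: for a field with [2 ^ r] elements let [T u] be the sum
    of the [u ^+ (2 ^ j)] for [j < r].  The map that sends [x] to [u * T x] has
    rank one and trace [T u]; it is also the sum of the maps that send [x] to
    [u * x ^+ (2 ^ j)], and conjugation by multiplications shows that those with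
    [0 < j] have trace 0.  Hence multiplication by [u] has trace [T u]
    ([trace_mul_neq0]), and [T], a polynomial of degree less than [2 ^ r], has a
    non-zero value. *)

Set Implicit Arguments.
Unset Strict Implicit.
Unset Printing Implicit Defensive.

Import Order.TTheory GRing.Theory Num.Theory.
Local Open Scope quotient_scope.
Local Open Scope classical_set_scope.
Local Open Scope ring_scope.

(** * The trace of a finite field of characteristic 2 *)

Section FiniteFieldTrace.
Variables (F : finFieldType) (I : finType).
Variables (e : I -> F) (c : I -> {additive F -> 'F_2}).
Hypothesis expand : forall x, x = \sum_i e i *+ c i x.

(** The family [e] with the coordinates [c] plays the part of a basis of [F]
    over its prime field, and [linear_trace f] that of the trace of [f] as a
    linear endomorphism.  The field is kept additive, with ['F_2] acting by
    natural multiples, so that it does not need a second algebra structure. *)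
Definition linear_trace (f : F -> F) : 'F_2 := \sum_i c i (f (e i)).

Lemma mulrn_F2 (x : 'F_2) (y : 'F_2) : x *+ y = x * y.
Proof. by rewrite -[in RHS](natr_Zp y) mulr_natr. Qed.

Lemma additive_expand (A : zmodType) (f : F -> A) x :
  {morph f : y z / y + z} -> f x = \sum_i f (e i) *+ c i x.
Proof.
move=> fD; have f0 : f 0 = 0 by apply: (addrI (f 0)); rewrite -fD !addr0.
have fMn y n : f (y *+ n) = f y *+ n.
  by elim: n => [|n IH]; rewrite ?mulr0n // !mulrSr fD IH.
by rewrite {1}[x]expand (big_morph f fD f0); apply: eq_bigr => i _; rewrite fMn.
Qed.

(** This is the only property of the trace that the conjugation argument of
    [twisted_trace0] uses. *)
Lemma linear_traceC (f g : F -> F) :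
    {morph f : y z / y + z} -> {morph g : y z / y + z} ->
  linear_trace (f \o g) = linear_trace (g \o f).
Proof.
move=> fD gD.
have E (f1 g1 : F -> F) : {morph f1 : y z / y + z} -> linear_trace (f1 \o g1) =
    \sum_i \sum_j c i (f1 (e j)) * c j (g1 (e i)).
  move=> f1D; apply: eq_bigr => i _ /=; rewrite (additive_expand _ f1D) raddf_sum.
  by apply: eq_bigr => j _; rewrite raddfMn mulrn_F2.
rewrite !E // exchange_big; apply: eq_bigr => i _; apply: eq_bigr => j _.
exact: mulrC.
Qed.

Lemma pchar2 : 2%N \in [pchar F].
Proof.
rewrite inE /=; apply/eqP; rewrite [LHS]expand big1 // => i _.
suff -> : c i 2%:R = 0 by rewrite mulr0n.
by rewrite raddfMn -mulr_natr pchar_Zp ?mulr0.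
Qed.

(** The sum of the conjugates of [x]: the trace of [F] over its prime field in
    the sense of Galois theory. *)
Definition absolute_trace (x : F) : F := \sum_(j < logn 2 #|F|) x ^+ (2 ^ j).

Lemma card_pow2 : #|F| = (2 ^ logn 2 #|F|)%N.
Proof.
have Fp := abelem_pgroup (fin_ring_pchar_abelem pchar2).
by rewrite -{1}cardsT (card_pgroup Fp) cardsT.
Qed.

Lemma degree_gt0 : (0 < logn 2 #|F|)%N.
Proof.
by rewrite -(ltn_exp2l 0 _ (isT : 1 < 2)%N) -card_pow2 expn0 finNzRing_gt1.
Qed.

Lemma exprD_pow2 j : {morph (fun x : F => x ^+ (2 ^ j)) : x y / x + y}.
Proof. by move=> x y; rewrite exprDn_pchar // pnatX pnatE ?pchar2. Qed.

Lemma absolute_traceD : {morph absolute_trace : x y / x + y}.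
Proof.
by move=> x y; rewrite -big_split; apply: eq_bigr => j _; rewrite exprD_pow2.
Qed.

(** Squaring permutes the terms of the sum cyclically, since
    [x ^+ #|F| = x]; so the value is fixed by the Frobenius map. *)
Lemma absolute_trace_01 x : (absolute_trace x == 0) || (absolute_trace x == 1).
Proof.
suff : absolute_trace x ^+ 2 = absolute_trace x.
  move/eqP; rewrite -subr_eq0 expr2 -{3}[absolute_trace x]mulr1 -mulrBr mulf_eq0.
  by rewrite subr_eq0.
rewrite /absolute_trace.
have -> : (\sum_(j < logn 2 #|F|) x ^+ (2 ^ j)) ^+ 2 =
    \sum_(j < logn 2 #|F|) x ^+ (2 ^ j.+1).
  have sq2 : {morph (fun x : F => x ^+ 2) : x y / x + y} := exprD_pow2 1.
  rewrite (big_morph _ sq2 (expr0n _ _)).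
  by apply: eq_bigr => j _; rewrite -exprM expnSr.
have r0 := degree_gt0.
move: card_pow2 (expf_card x); case: (logn 2 #|F|) r0 => // r _ Fr xF.
by rewrite big_ord_recr [in RHS]big_ord_recl /= -Fr xF expr1 addrC.
Qed.

(** The absolute trace is a polynomial function, and its degree is half the
    number of elements of [F]. *)
Lemma absolute_trace_neq0 : exists u, absolute_trace u != 0.
Proof.
apply/existsP; apply: contraT; rewrite negb_exists => /forallP T0.
have r0 := degree_gt0.
pose p : {poly F} := \sum_(j < logn 2 #|F|) 'X^(2 ^ j).
have pE x : p.[x] = absolute_trace x.
  by rewrite horner_sum; apply: eq_bigr => j _; rewrite hornerXn.
have p0 : p != 0.
  apply: contraTneq (oner_neq0 F) => /(congr1 (fun q : {poly F} => q`_1)).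
  rewrite coef0 coef_sum (bigD1 (Ordinal r0)) //= coefXn big1 ?addr0 => [/eqP|j j0].
    by rewrite oner_eq0.
  rewrite coefXn; case: eqP => // e1; case/negP: j0; apply/eqP/val_inj => /=.
  by case: (nat_of_ord j) e1 => // k; rewrite expnS; lia.
have /max_poly_roots := p0; move=> /(_ (enum F)).
rewrite enum_uniq -cardE => /(_ _ isT).
have -> : all (root p) (enum F).
  by apply/allP => x _; rewrite rootE pE; move: (T0 x); rewrite negbK.
move=> /(_ isT); rewrite ltnNge => /negP; case.
apply: leq_trans (size_sum _ _ _) _; apply/bigmax_leqP => j _.
by rewrite size_polyXn [X in (_ < X)%N]card_pow2 ltn_exp2l.
Qed.

(** For [0 < j] some [b] is moved by the [j]-th power of Frobenius.
    Conjugating by the multiplication by [b] replaces the coefficient [a] by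
    [a * b ^+ (2 ^ j).-1] without changing the trace; the difference of the two
    coefficients is [a] times a non-zero constant, hence arbitrary. *)
Lemma twisted_trace0 (a : F) j : (0 < j < logn 2 #|F|)%N ->
  linear_trace (fun x => a * x ^+ (2 ^ j)) = 0.
Proof.
move=> /andP[j0 jr].
have [b b0 bj] : exists2 b : F, b != 0 & b ^+ (2 ^ j).-1 != 1.
  pose p : {poly F} := 'X^(2 ^ j) - 'X.
  have sp : size p = (2 ^ j).+1.
    rewrite size_polyDl ?size_polyXn // size_polyN size_polyX ltnS.
    by rewrite (@leq_exp2l 2 1).
  have p0 : p != 0 by rewrite -size_poly_eq0 sp.
  have [b pb] : exists b, ~~ root p b.
    apply/existsP; apply: contraT; rewrite negb_exists => /forallP T0.
    have /max_poly_roots := p0; move=> /(_ (enum F)).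
    rewrite enum_uniq -cardE => /(_ _ isT).
    have -> : all (root p) (enum F).
      by apply/allP => x _; move: (T0 x); rewrite negbK.
    by move=> /(_ isT); rewrite sp ltnS leqNgt {1}card_pow2 ltn_exp2l // jr.
  exists b.
    by apply: contraNneq pb => ->; rewrite rootE !hornerE expr0n expn_eq0 /= subrr.
  apply: contraNneq pb => b1; rewrite rootE !hornerE.
  by rewrite -[(2 ^ j)%N]prednK ?expn_gt0 // exprSr b1 mul1r subrr.
have traceE (f g : F -> F) : f =1 g -> linear_trace f = linear_trace g.
  by move=> fg; apply: eq_bigr => i _; rewrite fg.
have mulD (a1 : F) : {morph (fun x => a1 * x) : x y / x + y}.
  by move=> x y; rewrite mulrDr.
have cyc a1 : linear_trace (fun x => a1 * x ^+ (2 ^ j)) =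
              linear_trace (fun x => a1 * b ^+ (2 ^ j).-1 * x ^+ (2 ^ j)).
  pose g x := b^-1 * (a1 * x ^+ (2 ^ j)).
  have gD : {morph g : x y / x + y}.
    by move=> x y; rewrite /g exprD_pow2 !mulrDr.
  rewrite (traceE _ ((fun x => b * x) \o g)); last first.
    by move=> x /=; rewrite /g mulVKf.
  rewrite linear_traceC //; apply: traceE => x /=; rewrite /g exprMn.
  have -> : b ^+ (2 ^ j) = b * b ^+ (2 ^ j).-1 by rewrite -exprS prednK ?expn_gt0.
  by rewrite [a1 * _]mulrCA -!mulrA mulKf // mulrCA !mulrA.
pose d := 1 - b ^+ (2 ^ j).-1.
have d0 : d != 0 by rewrite subr_eq0 eq_sym.
have := cyc (a / d); move/eqP; rewrite -subr_eq0 -sumrB => /eqP <-.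
apply: eq_bigr => i _; rewrite -raddfB; congr (c i _).
by rewrite -mulrBl -{1}[a / d]mulr1 -mulrBr -/d divfK.
Qed.

(** The map [fun x => u * absolute_trace x] has rank one, because the absolute
    trace takes its values in the prime field: its trace is
    [absolute_trace u].  Expanding the absolute trace and dropping the terms
    killed by [twisted_trace0] leaves the trace of the multiplication by [u]. *)
Lemma trace_mul_neq0 : exists u, linear_trace ( *%R u) != 0.
Proof.
have [u Tu] := absolute_trace_neq0.
exists u.
pose l x : 'F_2 := (absolute_trace x != 0)%:R.
have lE x : absolute_trace x = (l x)%:R.
  rewrite /l; have := absolute_trace_01 x.
  by case: (eqVneq (absolute_trace x) 0) => [->|_ /eqP ->].
have -> : linear_trace ( *%R u) = linear_trace (fun x => u * absolute_trace x).
  have r0 := degree_gt0.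
  transitivity (\sum_(j < logn 2 #|F|) linear_trace (fun x => u * x ^+ (2 ^ j))).
    rewrite (bigD1 (Ordinal r0)) //= big1 ?addr0 => [|j j0].
      by apply: eq_bigr => i _; rewrite expr1.
    apply: twisted_trace0; rewrite ltn_ord andbT lt0n.
    by apply: contraNneq j0 => e0; apply/eqP/val_inj.
  rewrite exchange_big; apply: eq_bigr => i _.
  by rewrite /absolute_trace mulr_sumr raddf_sum.
suff -> : linear_trace (fun x => u * absolute_trace x) = l u.
  by rewrite /l Tu.
have lD : {morph l : x y / x + y}.
  move=> x y; rewrite /l absolute_traceD.
  have := absolute_trace_01 x; have := absolute_trace_01 y.
  have two0 : 1 + 1 = 0 :> F by exact: (pcharf0 pchar2).
  case/orP=> /eqP ->; case/orP=> /eqP ->;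
    rewrite ?addr0 ?add0r ?two0 ?eqxx ?oner_eq0 //=; exact/val_inj.
rewrite (additive_expand u lD); apply: eq_bigr => i _.
by rewrite lE mulrn_F2 mulr_natr raddfMn mulrn_F2 mulrC.
Qed.

End FiniteFieldTrace.

(** The same result for a ring that is not known beforehand to be a finite
    field: the coordinates make it finite, and [kV] makes it a field.  It is
    meant for the quotient ring [residue_field K]. *)
Lemma finite_field_trace_neq0 (k : comNzRingType) (I : finType) (e : I -> k)
    (c : I -> {additive k -> 'F_2}) :
    (forall x : k, x != 0 -> exists y, y * x = 1) ->
    (forall x, x = \sum_i e i *+ c i x) ->
  exists u, \sum_i c i (u * e i) != 0.
Proof.
move=> kV expand.
pose enc x := [ffun i => c i x]; pose dec (f : {ffun I -> 'F_2}) := \sum_i e i *+ f i.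
have encK : cancel enc dec.
  by move=> x; rewrite [RHS]expand; apply: eq_bigr => i _; rewrite ffunE.
pose unit : pred k := fun x => x != 0.
have ex_inv (x : k) : exists y, (x == 0) || (y * x == 1).
  have [->|x0] := eqVneq x 0; first by exists 0.
  by have [y yx] := kV x x0; exists y; rewrite yx eqxx orbT.
pose inv x := if unit x then xchoose (ex_inv x) else x.
have mulVk : {in unit, left_inverse 1 inv *%R}.
  move=> x ux; rewrite /inv; have := ux; rewrite -topredE /= => ux'; rewrite ux'.
  by case/orP: (xchooseP (ex_inv x)) => /eqP // x0; rewrite /unit x0 eqxx in ux'.
have unitPl (x y : k) : y * x = 1 -> unit x.
  by move=> yx; apply: contra_eq_neq yx => ->; rewrite mulr0 eq_sym oner_eq0.
have inv_out : {in [predC unit], inv =1 id}.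
  by move=> x; rewrite inE /= /inv -topredE /= => /negbTE ->.
pose kU : comUnitRingType := HB.pack k
  (GRing.ComNzRing_hasMulInverse.Build k mulVk unitPl inv_out).
have kF : GRing.field_axiom kU by [].
pose kD : fieldType := HB.pack kU (GRing.ComUnitRing_isField.Build kU kF).
pose kC : countType := HB.pack k (CanIsCountable encK).
pose kN : finType := HB.pack kC (CanIsFinite (encK : @cancel _ kC enc dec)).
pose F : finFieldType := HB.pack k kD kN.
exact: (@trace_mul_neq0 F I e c expand).
Qed.

(** * Two-adic integers *)

Section DyadicIntegers.
Implicit Types x y : Z2.

Lemma z2natE n m : (n%:R : Z2) m = (n%:Z %% 2 ^+ m)%Z.
Proof.
by elim: n => [|n IH] //=; rewrite mulrS /= IH modzDml modzDmr intS.
Qed.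

Lemma z2_pow2 m k : (2 ^+ k : Z2) m = (2 ^+ k %% 2 ^+ m)%Z.
Proof. by rewrite -natrX z2natE -[Posz _]natz natrX. Qed.

Lemma z2_pow2M0 m y : (2 ^+ m * y : Z2) m = 0.
Proof. by rewrite /= z2_pow2 modzz mul0r mod0z. Qed.

(** The quotient is read off the digits of [x] by a shift of [m] places. *)
Lemma z2_dvd_pow2 x m : x m = 0 -> exists y, x = 2 ^+ m * y.
Proof.
move=> xm0; have dvd k : (2 ^+ m %| x (k + m)%N)%Z.
  by apply/dvdz_mod0P; rewrite z2mod_le z2mod.
have xE k : x (k + m)%N = (x (k + m)%N %/ 2 ^+ m)%Z * 2 ^+ m by rewrite divzK.
pose f k := (x (k + m)%N %/ 2 ^+ m)%Z.
have fS k : (f k.+1 = f k %[mod 2 ^+ k])%Z.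
  have p0 : (2 ^+ m != 0 :> int) by rewrite expf_neq0.
  apply/eqP; rewrite eqz_mod_dvd -(dvdz_mul2r p0) mulrBl -!xE -exprD.
  by rewrite -eqz_mod_dvd addSn [in X in _ == X]z2S modz_mod.
exists (MkZ2 (z2_coherent fS)); apply: z2_eq => k /=; rewrite z2_pow2 modzMml modzMmr.
by rewrite mulrC -xE addnC z2mod_le z2mod.
Qed.

Lemma z2_01 x : x 1%N = 0 \/ x 1%N = 1.
Proof.
rewrite -z2mod expr1.
have := modz_ge0 (x 1%N) (isT : 2 != 0 :> int).
have := ltz_pmod (x 1%N) (isT : 0 < 2 :> int).
lia.
Qed.

Lemma z2_odd_part x : x != 0 -> exists m u, x = 2 ^+ m * u /\ u 1%N = 1.
Proof.
move=> x0; have [m xm] : exists m, x m.+1 != 0.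
  apply: contrapT => /forallNP H; move/eqP: x0; apply; apply: z2_eq => m.
  rewrite z2val0; have /negP := H m; rewrite negbK => /eqP xm.
  by rewrite z2S xm mod0z.
case: (ex_minnP (ex_intro (fun m => x m.+1 != 0) m xm)) => {xm}m xm min.
have [u xu] : exists u, x = 2 ^+ m * u.
  case: m xm min => [|m] xm min; first by exists x; rewrite mul1r.
  by apply: z2_dvd_pow2; apply: contraTeq isT => /min; rewrite ltnn.
exists m, u; split=> //.
have : u 1%N != 0.
  apply: contra_neq xm => /z2_dvd_pow2 [y uy].
  by rewrite xu uy mulrA -exprSr z2_pow2M0.
by case: (z2_01 u) => ->.
Qed.

Lemma z2_odd x : x 1%N = 1 -> exists t, x = 1 + 2 * t.
Proof.
move=> x1; have [t xt] : exists t, x - 1 = 2 ^+ 1 * t.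
  by apply: z2_dvd_pow2; rewrite /= x1.
by exists t; rewrite -[x](subrK 1) xt expr1 addrC.
Qed.

Lemma z2_even x : x 1%N = 0 -> exists t, x = 2 * t.
Proof. by move=> /z2_dvd_pow2 [t ->]; exists t; rewrite expr1. Qed.

(** Completeness of the two-adic integers.  The limit [s] is only described by
    its remainders modulo all powers of 2, which is how [OK_pow2_separated]
    consumes it. *)
Lemma z2_series (f : nat -> Z2) : exists s : Z2, forall m, exists t,
  s = \sum_(j < m) 2 ^+ j * f j + 2 ^+ m * t.
Proof.
pose S m := \sum_(j < m) 2 ^+ j * f j.
have SS m : (S m.+1 m.+1 = S m m %[mod 2 ^+ m])%Z.
  rewrite z2mod -z2S /S big_ord_recr /= z2_pow2 modzz mul0r mod0z addr0.
  by rewrite z2mod.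
exists (MkZ2 (z2_coherent SS)) => m.
have [t st] : exists t, MkZ2 (z2_coherent SS) - S m = 2 ^+ m * t.
  by apply: z2_dvd_pow2; rewrite /= z2mod modzDmr subrr mod0z.
by exists t; rewrite -st addrC subrK.
Qed.

Lemma intr_Zp_mod (p : nat) (a b : int) : (1 < p)%N -> (a = b %[mod p])%Z ->
  a%:~R = b%:~R :> 'Z_p.
Proof.
move=> p1 ab; rewrite (divz_eq a p) (divz_eq b p) ab !intrD !intrM.
by rewrite -!pmulrn pchar_Zp // !mulr0.
Qed.

Definition z2_mod2 (x : Z2) : 'F_2 := (x 1%N)%:~R.

Lemma z2_mod2D : {morph z2_mod2 : x y / x + y}.
Proof.
move=> x y; rewrite /z2_mod2 -intrD.
by apply: (@intr_Zp_mod 2); rewrite //= modz_mod.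
Qed.
Lemma z2_mod20 : z2_mod2 0 = 0.
Proof. by rewrite /z2_mod2 z2val0. Qed.
Lemma z2_mod4D : {morph z2_mod4 : x y / x + y}.
Proof.
move=> x y; rewrite /z2_mod4 -intrD.
by apply: (@intr_Zp_mod 4); rewrite //= modz_mod.
Qed.

Lemma z2_mod2_eq0 x : (z2_mod2 x == 0) = (x 1%N == 0).
Proof. by rewrite /z2_mod2; case: (z2_01 x) => ->. Qed.

Lemma q2_denominator (a : Q2) : exists2 z : Z2, z != 0 & exists w : Z2,
  tofrac z * a = tofrac w.
Proof.
elim/quotW: a => r; exists \d_r; first exact: denom_ratioP.
exists \n_r; apply/eqP; rewrite piE /FracField.equivf /FracField.mulf.
by rewrite !numden_Ratio ?oner_eq0 ?mul1r ?mulr1 ?denom_ratioP // mulrC.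
Qed.

End DyadicIntegers.

(** * The ring of integers as a free module over the two-adic integers *)

Lemma q2_common_denominator (I : finType) (a : I -> Q2) :
  exists2 z : Z2, z != 0 & exists w : I -> Z2, forall i, tofrac z * a i = tofrac (w i).
Proof.
have /boolp.choice [z zP] i :
    exists z : Z2, z != 0 /\ exists w, tofrac z * a i = tofrac w.
  by have [z z0 zw] := q2_denominator (a i); exists z.
exists (\prod_i z i).
  by rewrite prodf_seq_neq0; apply/allP => i _ /=; case: (zP i).
have /boolp.choice [w wP] i : exists w : Z2, tofrac (z i) * a i = tofrac w.
  by case: (zP i).
exists (fun i => \prod_(j | j != i) z j * w i) => i.
by rewrite (bigD1 i) //= !rmorphM /= -wP mulrAC mulrC.
Qed.

(** Clearing denominators: if [z] is a common denominator of the coefficients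
    of a monic polynomial of degree [n] that vanishes at [x], then [z * x] is a
    root of the monic polynomial with coefficients [q`_i * z ^+ (n - i)]. *)
Lemma integral_multiple_root (K : comNzRingType) (f : {rmorphism Q2 -> K})
    (q : {poly Q2}) x : q \is monic -> root (map_poly f q) x ->
  exists2 z : Z2, z != 0 & `[< integralOver (f \o @tofrac Z2) (f (tofrac z) * x) >].
Proof.
move=> qmon /rootP qx; set n := (size q).-1.
have sq : size q = n.+1 by rewrite /n prednK // size_poly_gt0 monic_neq0.
have [z z0 [w wP]] := q2_common_denominator (fun i : 'I_n => q`_i).
exists z => //; apply/asboolP.
pose r : {poly Z2} :=
  'X^n + \poly_(i < n) (if insub i is Some j then z ^+ (n - i).-1 * w j else 0).
exists r.
  rewrite monicE lead_coefDl ?lead_coefXn ?size_polyXn //.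
  exact: leq_ltn_trans (size_poly _ _) _.
have lq : q`_n = 1 by rewrite -(monicP qmon) lead_coefE sq.
move: qx; rewrite horner_coef size_map_poly_id0; last first.
  by rewrite (monicP qmon) rmorph1 oner_neq0.
rewrite sq big_ord_recr /= coef_map /= lq rmorph1 mul1r => qx0.
rewrite rootE rmorphD /= hornerD map_polyXn hornerXn.
rewrite (@horner_coef_wide _ n); last by rewrite (leq_trans (size_poly _ _)) ?size_poly.
apply/eqP; rewrite -[RHS](mulr0 (f (tofrac z) ^+ n)) -[X in _ = _ * X]qx0.
rewrite exprMn mulrDr addrC mulr_sumr.
congr (_ + _); apply: eq_bigr => i _.
rewrite !coef_map coef_poly ltn_ord insubT ?ltn_ord // => lt_i /=.
have -> : Sub (i : nat) lt_i = i by apply: val_inj.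
have zi : f (tofrac z) ^+ n =
    f (tofrac z) ^+ (n - i).-1 * f (tofrac z) * f (tofrac z) ^+ i.
  rewrite -exprSr -exprD; congr (_ ^+ _); have := ltn_ord i; lia.
rewrite zi !rmorphM !rmorphXn exprMn /= -wP rmorphM /=.
move: (_ ^+ _) (f _) (f _) (_ ^+ _) (_ ^+ _) => u1 u2 u3 u4 u5.
by rewrite -!mulrA; congr (_ * (_ * _)); rewrite mulrCA.
Qed.

Section Integers.
Variable K : fieldExtType Q2.
Local Notation OK := (OK K).
Local Notation iK := (Z2inK K).

Lemma Z2inK_inj : injective iK.
Proof.
move=> x y; rewrite /Z2inK /=; move/(fmorph_inj (in_alg K)) => /eqP.
by rewrite tofrac_eq => /eqP.
Qed.

Lemma integral_closureZ2 z : integral_closure (iK z).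
Proof. by apply/asboolP; apply: integral_id. Qed.

Definition Z2toOK z : OK := MkOK (integral_closureZ2 z).

Lemma Z2toOK_zmod_morphism : zmod_morphism Z2toOK.
Proof. by move=> x y; apply: val_inj; exact: (rmorphB iK). Qed.
Lemma Z2toOK_monoid_morphism : monoid_morphism Z2toOK.
Proof.
by split=> [|x y]; apply: val_inj; [exact: (rmorph1 iK) | exact: (rmorphM iK)].
Qed.
HB.instance Definition _ :=
  GRing.isZmodMorphism.Build Z2 OK Z2toOK Z2toOK_zmod_morphism.
HB.instance Definition _ :=
  GRing.isMonoidMorphism.Build Z2 OK Z2toOK Z2toOK_monoid_morphism.

Lemma OK_mul_eq0 (x y : OK) : x * y = 0 -> x = 0 \/ y = 0.
Proof.
move/(congr1 val); rewrite rmorphM rmorph0 => /eqP; rewrite mulf_eq0.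
by case/orP=> /eqP xy; [left|right]; apply: val_inj.
Qed.


Lemma OK_mul2I (x y : OK) : 2 * x = 2 * y -> x = y.
Proof.
move=> e; apply/eqP; rewrite -subr_eq0; apply/eqP.
have /OK_mul_eq0 [/(congr1 val)|//] : 2 * (x - y) = 0 by rewrite mulrBr e subrr.
move=> e2; have : iK 2%:R = iK 0.
  by rewrite rmorph0 rmorph_nat -[RHS]e2 -[RHS]/(val (2%:R : OK)) rmorph_nat.
by move/Z2inK_inj/(congr1 (fun z : Z2 => z 2%N)).
Qed.

Lemma OK_mul_pow2I m (x y : OK) : 2 ^+ m * x = 2 ^+ m * y -> x = y.
Proof.
by elim: m => [|m IH]; rewrite ?mul1r // exprS -!mulrA => /OK_mul2I.
Qed.

Lemma integral_multiple (x : K) :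
  exists2 z : Z2, z != 0 & integral_closure (iK z * x).
Proof.
have /polyOver1P [q qE] := minPolyOver 1%AS x.
have qmon := monic_minPoly 1%AS x; have qx := root_minPoly 1%AS x.
rewrite {}qE in qmon qx; rewrite map_monic in qmon.
exact: integral_multiple_root qmon qx.
Qed.

End Integers.

Section Unramified.
Variable K : fieldExtType Q2.
Hypothesis hunr : unramified K.
Local Notation OK := (OK K).
Local Notation iK := (Z2inK K).
Local Notation z2 := (Z2toOK K).

Lemma OK_unit_or_double (x : OK) : (exists y, x * y = 1) \/ (exists y, x = 2 * y).
Proof.
by have [?|/hunr ?] := pselect (exists y : OK, x * y = 1); [left|right].
Qed.

Lemma Z2toOK_double (z : Z2) : (exists y, z2 z = 2 * y) -> z 1%N = 0.
Proof.
case=> y zy; case: (z2_01 z) => // /z2_odd [t zt].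
case: (@OK_not_half K (y - z2 t)).
by rewrite mulrBr -zy zt rmorphD rmorphM rmorph1 rmorph_nat addrK.
Qed.

(** The denominator [z] of [integral_multiple] is a power of 2 times an odd
    [u], and [u] is a unit of [O_K]: otherwise it would be a multiple of 2,
    and so would 1. *)
Lemma OK_pow2_multiple (x : K) : exists m (y : OK), 2 ^+ m * x = OKval y.
Proof.
have [z z0 zx] := integral_multiple x.
have [m [u [zu u1]]] := z2_odd_part z0.
have [[v uv]|/Z2toOK_double] := OK_unit_or_double (z2 u); last by rewrite u1.
exists m, (v * MkOK zx).
have uvK : iK u * OKval v = 1 by have := congr1 val uv; rewrite rmorphM rmorph1.
rewrite -[RHS]/(OKval v * (iK z * x)) zu rmorphM rmorphXn rmorph_nat.
rewrite mulrC -!mulrA [2 ^+ m * (iK u * x)]mulrCA [OKval v * _]mulrA.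
by rewrite [OKval v * _]mulrC uvK mul1r mulrC.
Qed.

(** If [x] is not 0, then [2 ^+ m / x] is integral for some [m].  Were [x]
    divisible by [2 ^+ m.+1], then 2 would divide 1. *)
Lemma OK_pow2_separated (x : OK) : (forall m, exists y, x = 2 ^+ m * y) -> x = 0.
Proof.
move=> xdvd; apply: contrapT => /eqP x0.
have xK : OKval x != 0 by apply: contra_neq x0 => x0; apply: val_inj.
have [m [y xy]] := OK_pow2_multiple (OKval x)^-1.
have [w xw] := xdvd m.+1.
case: (@OK_not_half K (w * y)); apply: (@OK_mul_pow2I K m).
rewrite !mulrA -exprSr -xw mulr1; apply: val_inj.
rewrite -[RHS]/(OKval x * OKval y) -xy mulrCA divff ?mulr1 //.
by rewrite rmorphXn rmorph_nat.
Qed.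

Lemma OKval_combination r (e : 'I_r -> OK) (c : 'I_r -> Z2) :
  OKval (\sum_i z2 (c i) * e i) = \sum_i tofrac (c i) *: OKval (e i).
Proof.
rewrite [LHS](rmorph_sum val); apply: eq_bigr => i _.
by rewrite [LHS](rmorphM val); exact: mulr_algl.
Qed.

(** The coefficients are two-adic integers of which only the parity matters:
    this avoids choosing representatives of ['F_2], and lets the relation be
    divided by 2 in [free_mod2_free]. *)
Definition free_mod2 r (e : 'I_r -> OK) : Prop :=
  forall c : 'I_r -> Z2, (exists y, \sum_i z2 (c i) * e i = 2 * y) ->
  forall i, c i 1%N = 0.

Definition generates_mod2 r (e : 'I_r -> OK) : Prop :=
  forall x : OK, exists (c : 'I_r -> Z2) y, x = \sum_i z2 (c i) * e i + 2 * y.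

Section FreeMod2.
Variables (r : nat) (e : 'I_r -> OK).
Hypothesis e_free : free_mod2 e.

(** Infinite descent: all coefficients of a relation are even, and dividing
    them by 2 gives another relation. *)
Lemma free_mod2_free (c : 'I_r -> Z2) :
  \sum_i z2 (c i) * e i = 0 -> forall i, c i = 0.
Proof.
suff c0 m : forall c : 'I_r -> Z2, \sum_i z2 (c i) * e i = 0 -> forall i, c i m = 0.
  by move=> ce i; apply: z2_eq => m; rewrite z2val0; apply: c0.
elim: m => [|m IH] {}c ce i; first by rewrite -z2mod expr0 modz1.
have /boolp.choice [c' cc'] j : exists t, c j = 2 * t.
  by apply: z2_even; apply: e_free; exists 0; rewrite mulr0.
have c'e : \sum_i z2 (c' i) * e i = 0.
  apply: (@OK_mul2I K); rewrite mulr0 -[RHS]ce mulr_sumr; apply: eq_bigr => j _.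
  by rewrite cc' rmorphM rmorph_nat mulrA.
have [t ct] := z2_dvd_pow2 (IH _ c'e i).
by rewrite cc' ct mulrA -exprS z2_pow2M0.
Qed.

Lemma free_mod2_freeK : free [tuple OKval (e i) | i < r].
Proof.
apply/freeP => k ke i; have [z z0 [w wP]] := q2_common_denominator k.
have we : \sum_i z2 (w i) * e i = 0.
  apply: val_inj; rewrite [LHS]OKval_combination -[RHS](scaler0 _ (tofrac z)).
  rewrite -[X in _ = _ *: X]ke scaler_sumr; apply: eq_bigr => j _.
  by rewrite scalerA wP -tnth_nth tnth_mktuple.
have /eqP := wP i; rewrite (free_mod2_free we i) rmorph0 mulf_eq0 tofrac_eq0.
by rewrite (negbTE z0) => /eqP.
Qed.

Lemma free_mod2_dim : (r <= \dim {:K})%N.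
Proof.
have /eqP := free_mod2_freeK; rewrite size_tuple => <-.
exact/dimvS/subvf.
Qed.

End FreeMod2.

(** A family that is free modulo 2 is free over [Q2], so its size is bounded by
    the dimension of [K]; one of maximal size generates modulo 2. *)
Lemma exists_free_generates : exists r (e : 'I_r -> OK), free_mod2 e /\ generates_mod2 e.
Proof.
pose P r := `[< exists e : 'I_r -> OK, free_mod2 e >].
have P0 : P 0%N by apply/asboolP; exists (fun _ => 0); move=> c _ [].
have Pb r : P r -> (r <= \dim {:K})%N by move/asboolP => [e]; exact: free_mod2_dim.
case: (ex_maxnP (ex_intro P 0%N P0) Pb) => r /asboolP [e e_free] rmax.
exists r, e; split=> // x.
pose e' (i : 'I_r.+1) := if unlift ord_max i is Some j then e j else x.
have e'sum (c : 'I_r.+1 -> Z2) : \sum_i z2 (c i) * e' i =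
    \sum_(i < r) z2 (c (lift ord_max i)) * e i + z2 (c ord_max) * x.
  rewrite big_ord_recr /= /e' unlift_none; congr (_ + _).
  apply: eq_bigr => i _; have -> : widen_ord (leqnSn r) i = lift ord_max i.
    by apply: val_inj; rewrite /= /bump leqNgt ltn_ord.
  by rewrite liftK.
have : ~ free_mod2 e'.
  move=> e'_free; have := rmax r.+1; rewrite ltnn => H.
  by suff: false by []; apply/H/asboolP; exists e'.
move=> /existsNP [c /not_implyP [[y cy] /existsNP [i ci]]].
(* The coefficient of x is odd: an even one can be moved to the right-hand side,
   which leaves a relation between the members of e. *)
have := cy; rewrite e'sum.
case: (z2_01 (c ord_max)) => [/z2_even [t ct]|/z2_odd [t ct]] cxy.
  have c0 : forall j, c (lift ord_max j) 1%N = 0.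
    apply: (e_free (fun j => c (lift ord_max j))); exists (y - z2 t * x).
    by rewrite mulrBr -cxy ct rmorphM rmorph_nat mulrA addrK.
  case: ci; case: (unliftP ord_max i) => [j ->|->]; first exact: c0.
  by rewrite ct -[2]expr1 z2_pow2M0.
exists (fun j => - c (lift ord_max j)), (y - z2 t * x).
rewrite mulrBr -cxy ct rmorphD rmorphM rmorph1 rmorph_nat mulrDl mul1r mulrA.
rewrite (eq_bigr (fun j => - (z2 (c (lift ord_max j)) * e j))); last first.
  by move=> j _; rewrite rmorphN mulNr.
rewrite sumrN; move: (\sum_(_ < _) _) (2 * _ * x) => u v.
by rewrite [u + _]addrA addrK addKr.
Qed.

End Unramified.

Section IntegralBasis.
Variable K : fieldExtType Q2.
Hypothesis hunr : unramified K.
Local Notation OK := (OK K).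
Local Notation iK := (Z2inK K).
Local Notation z2 := (Z2toOK K).

(** Successive approximation: writing [x] as a combination of the lifts [e]
    plus [2 * y], and then [y] in the same way, gives the two-adic digits of
    the coordinates of [x].  The resulting family is free over [Q2] and spans
    [K], because every element of [K] has an integral multiple by a power of 2;
    so it has exactly [\dim {:K}] elements. *)
Lemma exists_integral_basis : exists e : 'I_(\dim {:K}) -> OK,
  basis_of {:K} [tuple OKval (e i) | i < \dim {:K}] /\
  (forall x : OK, exists c : 'I_(\dim {:K}) -> Z2, x = \sum_i z2 (c i) * e i).
Proof.
have [r [e [e_free e_gen]]] := exists_free_generates K.
have e_span (x : OK) : exists c : 'I_r -> Z2, x = \sum_i z2 (c i) * e i.
  have /boolp.choice [c] := e_gen; move=> /boolp.choice [y yP].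
  pose digit j i := c (iter j y x) i.
  have /boolp.choice [s sP] := fun i => z2_series (digit^~ i).
  have expand m : x =
      \sum_i z2 (\sum_(j < m) 2 ^+ j * digit j i) * e i + 2 ^+ m * iter m y x.
    elim: m => [|m IH].
      by rewrite mul1r big1 ?add0r // => i _; rewrite big_ord0 rmorph0 mul0r.
    rewrite {1}IH [iter m y x]yP mulrDr [in RHS]iterS mulrA -exprSr addrA.
    congr (_ + _).
    rewrite mulr_sumr -big_split; apply: eq_bigr => i _ /=.
    by rewrite big_ord_recr rmorphD mulrDl rmorphM rmorphXn rmorph_nat mulrA.
  exists s; apply/eqP; rewrite -subr_eq0; apply/eqP.
  apply: (@OK_pow2_separated K hunr) => m.
  have /boolp.choice [t tP] := fun i => sP i m.
  exists (iter m y x - \sum_i z2 (t i) * e i).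
  rewrite {1}(expand m) mulrBr.
  have -> : \sum_i z2 (s i) * e i =
     \sum_i z2 (\sum_(j < m) 2 ^+ j * digit j i) * e i + 2 ^+ m * \sum_i z2 (t i) * e i.
    rewrite mulr_sumr -big_split; apply: eq_bigr => i _ /=.
    by rewrite tP rmorphD mulrDl rmorphM rmorphXn rmorph_nat mulrA.
  by rewrite opprD addrACA subrr add0r.
have span_e : ({:K} <= <<[tuple OKval (e i) | i < r]>>)%VS.
  apply/subvP => x _.
  have [m [y xy]] := @OK_pow2_multiple K hunr x.
  have [c yc] := e_span y.
  have p0 : tofrac (2 ^+ m : Z2) != 0.
    by rewrite tofrac_eq0 expf_neq0 //; apply/eqP => /(congr1 (fun z : Z2 => z 2%N)).
  have -> : x = (tofrac (2 ^+ m : Z2))^-1 *: OKval y.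
    rewrite -xy; apply: (scalerI p0); rewrite scalerA divff // scale1r.
    rewrite -[LHS]mulr_algl; congr (_ * _).
    by rewrite -[LHS]/(iK (2 ^+ m)) rmorphXn rmorph_nat.
  rewrite memvZ // yc OKval_combination; apply: memv_suml => i _.
  by rewrite memvZ // memv_span //; apply/tnthP; exists i; rewrite tnth_mktuple.
have rd : r = \dim {:K}.
  apply/eqP; rewrite eqn_leq (free_mod2_dim e_free) /=.
  by move/dimvS: span_e => /leq_trans -> //; rewrite (leq_trans (dim_span _)) ?size_tuple.
subst r; exists e; split=> //.
by rewrite basisEdim span_e size_tuple leqnn.
Qed.

End IntegralBasis.

(** The field trace is defined with an arbitrary basis [b] of [K]; this lets it
    be computed in the integral basis. *)
Lemma mxtrace_mxof (F : fieldType) (vT : vectType F) (b e : (\dim {:vT}).-tuple vT)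
    (f : 'End(vT)) : basis_of {:vT} b -> basis_of {:vT} e ->
  \tr (passmx.mxof b b f) = \sum_(i < \dim {:vT}) coord e i (f e`_i).
Proof.
move=> bB eB.
transitivity (\sum_(i < \dim {:vT}) coord b i (f b`_i)).
  by apply: eq_bigr => i _; rewrite !mxE /= passmx.vecof_delta.
transitivity (\sum_(i < \dim {:vT}) \sum_(j < \dim {:vT})
    coord e j (f b`_i) * coord b i e`_j).
  apply: eq_bigr => i _; rewrite {1}(coord_basis eB (memvf (f b`_i))).
  by rewrite linear_sum; apply: eq_bigr => j _; rewrite linearZ.
rewrite exchange_big; apply: eq_bigr => j _.
rewrite {2}(coord_basis bB (memvf e`_j)) !linear_sum; apply: eq_bigr => i _.
by rewrite !linearZ mulrC.
Qed.

Section Trace.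
Variable K : fieldExtType Q2.
Local Notation OK := (OK K).
Local Notation z2 := (Z2toOK K).
Local Notation d := (\dim {:K}).
Variable e : 'I_d -> OK.
Hypothesis e_basis : basis_of {:K} [tuple OKval (e i) | i < d].
Hypothesis e_span : forall x : OK, exists c : 'I_d -> Z2, x = \sum_i z2 (c i) * e i.

Definition OKcoord (x : OK) : 'I_d -> Z2 := projT1 (cid (e_span x)).

Lemma OKcoordK x : x = \sum_i z2 (OKcoord x i) * e i.
Proof. exact: projT2 (cid (e_span x)). Qed.

Lemma coord_OKval x i :
  coord [tuple OKval (e i) | i < d] i (OKval x) = tofrac (OKcoord x i).
Proof.
rewrite {1}[x]OKcoordK OKval_combination.
under eq_bigr => j _.
  have -> : OKval (e j) = [tuple OKval (e i) | i < d]`_j.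
    by rewrite -tnth_nth tnth_mktuple.
  over.
by rewrite coord_sum_free // (basis_free e_basis).
Qed.

Lemma OKcoordD i : {morph OKcoord^~ i : x y / x + y}.
Proof.
move=> x y; apply/eqP; rewrite -tofrac_eq rmorphD /= -!coord_OKval.
by rewrite -raddfD.
Qed.

Lemma OKcoord_unique (c : 'I_d -> Z2) i : OKcoord (\sum_j z2 (c j) * e j) i = c i.
Proof.
apply/eqP; rewrite -tofrac_eq -coord_OKval OKval_combination.
under eq_bigr => j _.
  have -> : OKval (e j) = [tuple OKval (e i) | i < d]`_j.
    by rewrite -tnth_nth tnth_mktuple.
  over.
by rewrite coord_sum_free // (basis_free e_basis).
Qed.

(** The field trace with its integrality built in, see [field_trace_OK]. *)
Definition OKtrace (x : OK) : Z2 := \sum_i OKcoord (x * e i) i.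

Lemma OKtraceD : {morph OKtrace : x y / x + y}.
Proof.
by move=> x y; rewrite -big_split; apply: eq_bigr => i _; rewrite mulrDl OKcoordD.
Qed.

Lemma field_trace_OK (x : OK) : field_trace (OKval x) = tofrac (OKtrace x).
Proof.
rewrite /field_trace (mxtrace_mxof _ (vbasisP _) e_basis) rmorph_sum.
apply: eq_bigr => i _ /=; rewrite -coord_OKval lfunE /=; congr (coord _ _ _).
rewrite (nth_map i) ?size_enum_ord // nth_ord_enum mulrC.
exact: (esym (rmorphM (\val : OK -> K) _ _)).
Qed.

Lemma OKcoord_double x i : OKcoord (2 * x) i = 2 * OKcoord x i.
Proof. by rewrite !mulr_natl !mulr2n OKcoordD. Qed.

Lemma OKtrace_double x : OKtrace (2 * x) = 2 * OKtrace x.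
Proof. by rewrite !mulr_natl !mulr2n OKtraceD. Qed.

(** The trace is additive, so changing the representative by a multiple of 4
    changes it by a multiple of 4. *)
Lemma tr_pi (x : OK) : tr (\pi_(RK K) x) = z2_mod4 (OKtrace x).
Proof.
rewrite /tr; set P := (X in xget _ X).
have : P (z2_mod4 (OKtrace x)).
  by exists x, (OKtrace x); split=> //; exact: field_trace_OK.
move=> /(xgetI 0); case=> y [z [yx yz ->]].
have -> : z = OKtrace y by apply/eqP; rewrite -tofrac_eq -field_trace_OK yz.
move/eqP: yx; rewrite -Quotient.idealrBE => /asboolP [w yxw].
have {yxw} -> : y = x + 2 * (2 * w) by rewrite mulrA -expr2 -yxw addrC subrK.
rewrite OKtraceD !OKtrace_double z2_mod4D /z2_mod4 mulrA; move: (OKtrace w) => t.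
rewrite -[RHS]addr0; congr (_ + _).
have -> : 2 * 2 * t = 2 ^+ 2 * t by rewrite expr2.
by rewrite z2_pow2M0.
Qed.

Hypothesis hunr : unramified K.
Local Notation k := (residue_field K).

Definition rescoord i (c : k) : 'F_2 := z2_mod2 (OKcoord (repr c) i).

Lemma rescoord_pi i x : rescoord i (\pi_k x) = z2_mod2 (OKcoord x i).
Proof.
rewrite /rescoord; have /eqP : \pi_k (repr (\pi_k x)) = \pi_k x by rewrite reprK.
rewrite -Quotient.idealrBE => /asboolP [w]; move: (repr _) => y yxw.
have {yxw} -> : y = x + 2 * w by rewrite -[2]expr1 -yxw addrC subrK.
rewrite OKcoordD OKcoord_double z2_mod2D.
rewrite [X in _ + X](_ : _ = 0) ?addr0 //; apply/eqP.
by rewrite z2_mod2_eq0 -[2]expr1 z2_pow2M0.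
Qed.

Lemma rescoord_zmod_morphism i : zmod_morphism (rescoord i).
Proof.
move=> a b; rewrite -[a]reprK -[b]reprK -rmorphB !rescoord_pi.
by apply/eqP; rewrite -subr_eq opprK -z2_mod2D -OKcoordD subrK.
Qed.
HB.instance Definition _ i := GRing.isZmodMorphism.Build k 'F_2 (rescoord i)
  (rescoord_zmod_morphism i).

Lemma pi_k_double (x : OK) : \pi_k (2 * x) = 0.
Proof.
rewrite -(rmorph0 \pi_k); apply/eqP; rewrite -Quotient.idealrBE.
by apply/asboolP; exists x; rewrite subr0.
Qed.

Lemma pi_k_Z2 (c : Z2) : \pi_k (z2 c) = (z2_mod2 c)%:R.
Proof.
rewrite /z2_mod2; case: (z2_01 c) => c1; rewrite c1.
  by have [t ->] := z2_even c1; rewrite (rmorphM z2) (rmorph_nat z2) pi_k_double.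
have [t ->] := z2_odd c1.
rewrite (rmorphD z2) (rmorphM z2) (rmorph_nat z2) rmorphD /= pi_k_double.
by rewrite addr0 !rmorph1.
Qed.

Lemma rescoord_expand c : c = \sum_i \pi_k (e i) *+ rescoord i c.
Proof.
rewrite -[c]reprK; move: (repr c) => x.
rewrite {1}[x]OKcoordK raddf_sum; apply: eq_bigr => i _ /=.
by rewrite rescoord_pi -[RHS]mulr_natl -pi_k_Z2 -rmorphM.
Qed.

Lemma rescoord_sum (f : 'I_d -> 'F_2) i : rescoord i (\sum_j \pi_k (e j) *+ f j) = f i.
Proof.
have -> : \sum_j \pi_k (e j) *+ f j = \pi_k (\sum_j z2 (f j)%:R * e j).
  rewrite raddf_sum; apply: eq_bigr => j _ /=.
  by rewrite -[LHS]mulr_natl !rmorph_nat rmorphM rmorph_nat.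
rewrite rescoord_pi OKcoord_unique /z2_mod2 z2natE.
by case: (f i) => [[|[|m]] lt] //; apply: val_inj.
Qed.

(** Modulo 2, [OKtrace u] is the trace of the multiplication by the class of
    [u] on the residue field. *)
Lemma exists_odd_trace : exists u, OKtrace u 1%N = 1.
Proof.
have [] := @finite_field_trace_neq0 k _ (fun i => \pi_k (e i)) (fun i => rescoord i).
- move=> x; rewrite -[x]reprK; move: (repr x) => {}x x0.
  have [[y xy]|[y xy]] := OK_unit_or_double hunr x.
    by exists (\pi_k y); rewrite -rmorphM mulrC xy rmorph1.
  by move: x0; rewrite xy pi_k_double eqxx.
- exact: rescoord_expand.
move=> u; rewrite -[u]reprK; move: (repr u) => {}u.
under eq_bigr => i _ do rewrite -rmorphM /= rescoord_pi.
rewrite -(big_morph _ z2_mod2D z2_mod20) -/(OKtrace u) z2_mod2_eq0 => u1.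
by exists u; case: (z2_01 (OKtrace u)) u1 => ->.
Qed.

End Trace.

(** * Gaussian integers and finite character sums *)

(** If [a + i b] has norm [2 ^+ D] then its fourth power is [(-4) ^+ D]; the two
    equations are those of the real and imaginary parts.  For [D <= 1] there are
    at most four such Gaussian integers; for larger [D] both [a] and [b] are
    even, by reduction modulo 4, and one descends to [D - 2]. *)
Lemma gaussian_norm_pow2 (D : nat) (a b : int) : a ^+ 2 + b ^+ 2 = 2 ^+ D ->
  (a ^+ 2 - b ^+ 2) ^+ 2 - (2 * a * b) ^+ 2 = (-4) ^+ D /\
  (a ^+ 2 - b ^+ 2) * (a * b) = 0.
Proof.
have small (x y n : int) : n <= 2 -> x ^+ 2 + y ^+ 2 = n ->
    [\/ x = -1, x = 0 | x = 1].
  move=> n2 xy; have x1 : -1 <= x <= 1 by nia.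
  have : x = -1 \/ x = 0 \/ x = 1 by lia.
  by case=> [|[|]]; [constructor 1|constructor 2|constructor 3].
elim/ltn_ind: D a b => -[|[|D]] IH a b ab.
- have ba : b ^+ 2 + a ^+ 2 = 1 by rewrite addrC ab.
  by have [] := small a b 1 isT ab; have [] := small b a 1 isT ba;
    move=> eb ea; move: ab; rewrite ea eb.
- have ba : b ^+ 2 + a ^+ 2 = 2 by rewrite addrC ab.
  by have [] := small a b 2 isT ab; have [] := small b a 2 isT ba;
    move=> eb ea; move: ab; rewrite ea eb.
have [a1 [b1 [ea eb]]] : exists a1 b1, a = 2 * a1 /\ b = 2 * b1.
  exists (a %/ 2)%Z, (b %/ 2)%Z.
  have : (a ^+ 2 + b ^+ 2 = 4 * 2 ^+ D) by rewrite ab !exprS mulrA.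
  move: (2 ^+ D) => t {}ab.
  have := divz_eq a 2; have := divz_eq b 2.
  have : (0 <= a %% 2 < 2)%Z by rewrite modz_ge0 //= ltz_pmod.
  have : (0 <= b %% 2 < 2)%Z by rewrite modz_ge0 //= ltz_pmod.
  move: (a %/ 2)%Z (b %/ 2)%Z (a %% 2)%Z (b %% 2)%Z => q r s u hu hs eb ea.
  have hs' : s = 0 \/ s = 1 by lia.
  have hu' : u = 0 \/ u = 1 by lia.
  by case: hs' ea => ->; case: hu' eb => -> => eb ea; subst; nia.
have /IH [] : a1 ^+ 2 + b1 ^+ 2 = 2 ^+ D.
- move: ab; rewrite ea eb !exprS; move: (2 ^+ D) => t; lia.
- by rewrite ltnS leqnSn.
move=> e1 e2; rewrite !exprS -e1 ea eb; split; first ring.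
by rewrite -[RHS](mulr0 16) -e2; ring.
Qed.

Section FiniteSums.
Variables (C : idomainType).

Lemma fsum_shift (V : zmodType) (A : set V) (F : V -> C) (a : V) :
  (forall x, A x <-> A (a + x)) ->
  \sum_(x \in A) F (a + x) = \sum_(x \in A) F x.
Proof.
move=> Aa; apply/esym/(reindex_fsbig (fun x => a + x)); split.
- by move=> x /= /Aa.
- by move=> x y _ _ /addrI.
- by move=> y Ay; exists (y - a) => /=; [apply/Aa|]; rewrite addrC subrK.
Qed.

Lemma fsum1 (T : choiceType) (A : set T) : finite_set A ->
  \sum_(x \in A) (1 : C) = #|` fset_set A|%:R.
Proof. by move=> Af; rewrite fsbig_finite // big_const_seq count_predT iter_addr_0. Qed.

(** Translating the sum by [a] multiplies it by [F a], which is not 1. *)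
Lemma character_sum0 (V : zmodType) (A : set V) (F : V -> C) (a : V) :
    (forall x, A x <-> A (a + x)) -> (forall x, A x -> F (a + x) = F a * F x) ->
  F a != 1 -> \sum_(x \in A) F x = 0.
Proof.
move=> Aa FM Fa; apply/eqP.
have : (1 - F a) * (\sum_(x \in A) F x) == 0.
  rewrite mulrBl mul1r -{1}(fsum_shift F Aa) mulr_fsumr subr_eq0; apply/eqP.
  by apply: eq_fsbigr => x /set_mem /FM.
by rewrite mulf_eq0 subr_eq0 eq_sym (negbTE Fa).
Qed.

(** The norm of a Gauss sum.  Here [F] is the exponential of a quadratic
    function, [F'] its inverse, and [B] the exponential of the polar form.
    After the substitution [x = y + z] in the double sum, the sum over [y] is
    that of a character of [A], non-trivial unless [z = 0]. *)
Lemma gauss_sum_norm (V : zmodType) (A : set V) (F F' : V -> C) (B : V -> V -> C) :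
    finite_set A -> A 0 -> (forall a, A a -> forall x, A x <-> A (a + x)) ->
    F 0 = 1 ->
    (forall y z, A y -> A z -> F (y + z) * F' y = F z * B y z) ->
    (forall z y y', B (y + y') z = B y z * B y' z) ->
    (forall y, B y 0 = 1) ->
    (forall z, A z -> z <> 0 -> exists2 a, A a & B a z != 1) ->
  (\sum_(x \in A) F x) * (\sum_(x \in A) F' x) = #|` fset_set A|%:R.
Proof.
move=> Af A0 Ashift F0 FB BD B0 Bnd.
rewrite mulr_fsumr (eq_fsbigr (fun y => \sum_(z \in A) F z * B y z)); last first.
  move=> y /set_mem Ay; rewrite mulr_fsuml -(fsum_shift _ (Ashift y Ay)).
  by apply: eq_fsbigr => z /set_mem Az; apply: FB.
rewrite exchange_fsbig // (fsbigD1 0) //= [X in _ + X]fsbig1 ?addr0.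
  by rewrite -fsum1 //; apply: eq_fsbigr => y _; rewrite F0 B0 mul1r.
move=> z [Az z0]; rewrite -mulr_fsumr; have [a Aa Ba] := Bnd z Az z0.
by rewrite (@character_sum0 V A (B^~ z) a (Ashift a Aa)) ?mulr0.
Qed.

End FiniteSums.

(** Counting by sums of 1, so that reindexing does the work. *)
Lemma card_set_bij (T1 T2 U : choiceType) (A : set T1) (B : set T2) (D : set U) h :
    finite_set A -> finite_set B -> finite_set D -> set_bij (A `*` B) D h ->
  #|` fset_set D| = (#|` fset_set A| * #|` fset_set B|)%N.
Proof.
move=> fA fB fD hbij; apply/eqP; rewrite -(eqr_nat int) natrM -!(fsum1 int) //.
rewrite (reindex_fsbig h _ _ _ hbij) -(pair_fsbig _ (fun _ _ => 1)) //.
rewrite mulr_fsuml; apply/eqP/eq_fsbigr => a _; exact: esym (mul1r _).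
Qed.

Section GaussianIntegers.
Variable Rr : realType.

Definition gaussian (a b : int) : Rr[i] := (a%:~R +i* b%:~R)%C.

Lemma gaussianM a b c d :
  gaussian a b * gaussian c d = gaussian (a * c - b * d) (a * d + b * c).
Proof. by rewrite /gaussian !intrD mulrNz !intrM. Qed.
Lemma gaussianD a b c d : gaussian a b + gaussian c d = gaussian (a + c) (b + d).
Proof. by rewrite /gaussian !intrD. Qed.
Lemma gaussian_nat (n : nat) : gaussian n 0 = n%:R.
Proof.
by elim: n => [|n IH]; rewrite // mulrS -IH -[1]/(gaussian 1 0) gaussianD addr0 -intS.
Qed.

Lemma expi_quarter n : expi (2 * pi / 4 * n%:R : Rr) =
  nth 0 [:: gaussian 1 0; gaussian 0 1; gaussian (-1) 0; gaussian 0 (-1)] (n %% 4).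
Proof.
have -> : 2 * pi / 4 = pi / 2 :> Rr by field.
have e2 m : expi (pi / 2 * m.+2%:R : Rr) = - expi (pi / 2 * m%:R).
  rewrite /expi.
  have -> : pi / 2 * m.+2%:R = pi / 2 * m%:R + pi / 2 + pi / 2 :> Rr.
    by rewrite -[m.+2]addn2 natrD; field.
  by rewrite cosDpihalf sinDpihalf sinDpihalf cosDpihalf.
have e0 : expi (pi / 2 * 0%:R : Rr) = gaussian 1 0.
  by rewrite /expi mulr0 cos0 sin0.
have e1 : expi (pi / 2 * 1%:R : Rr) = gaussian 0 1.
  by rewrite /expi mulr1 cos_pihalf sin_pihalf.
have e4 m : expi (pi / 2 * (m + 4)%N%:R : Rr) = expi (pi / 2 * m%:R).
  by rewrite addn4 !e2 opprK.
rewrite (divn_eq n 4) modnMDl modn_mod.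
elim: (n %/ 4)%N => [|q IH]; last by rewrite mulSn -addnA addnC e4.
rewrite mul0n add0n; have : (n %% 4 < 4)%N by rewrite ltn_mod.
case: (n %% 4)%N => [|[|[|[|//]]]] _ //=; rewrite e2 ?e0 ?e1;
  by apply/eqP; rewrite eq_complex /= ?oppr0 ?mulr0z ?mulrNz ?eqxx.
Qed.

(** The function [F'] stands for the complex conjugate of [F]. *)
Lemma sum_gaussian (T : choiceType) (A : set T) (F F' : T -> Rr[i]) : finite_set A ->
    (forall x, exists a b, F x = gaussian a b /\ F' x = gaussian a (- b)) ->
  exists a b, \sum_(x \in A) F x = gaussian a b /\
    \sum_(x \in A) F' x = gaussian a (- b).
Proof.
move=> Af FG; rewrite !fsbig_finite //; elim: (enum_fset _) => [|x s [a [b [IH IH']]]].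
  by exists 0, 0; rewrite !big_nil oppr0.
have [c [d [Fx Fx']]] := FG x; exists (c + a), (d + b).
by rewrite !big_cons IH IH' Fx Fx' /= !gaussianD opprD.
Qed.

Lemma gaussian_Re_inj a b c d : gaussian a b = gaussian c d -> a = c.
Proof. by case=> /intr_inj. Qed.

Lemma gaussian_pow4 (D : nat) (G G' : Rr[i]) a b :
    G = gaussian a b -> G' = gaussian a (- b) ->
  G * G' = (2 ^ D)%:R -> G ^+ 4 = (-1) ^+ D * (2 ^ D)%:R ^+ 2.
Proof.
move=> -> ->; rewrite gaussianM => GG.
have /gaussian_Re_inj ab := etrans GG (esym (gaussian_nat _)).
have [re im] : (a ^+ 2 - b ^+ 2) ^+ 2 - (2 * a * b) ^+ 2 = (-4) ^+ D /\
    (a ^+ 2 - b ^+ 2) * (a * b) = 0.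
  by apply: gaussian_norm_pow2; rewrite -[RHS]natrX natz -ab; ring.
rewrite (exprM _ 2 2) [gaussian a b ^+ 2]expr2 gaussianM [LHS]expr2 gaussianM.
have e4 : (-1) ^+ D * (2 ^ D)%:R ^+ 2 = gaussian ((-4) ^+ D) 0.
  have -> : gaussian ((-4) ^+ D) 0 = gaussian (-4) 0 ^+ D.
    elim: D {GG ab re im} => [|D IH] //.
    by rewrite !exprS -IH gaussianM !mulr0 mul0r subr0 addr0.
  have -> : gaussian (-4) 0 = (-1) * 2 ^+ 2.
    rewrite -natrX -gaussian_nat -[-1]/(- gaussian 1 0) /gaussian.
    by apply/eqP; rewrite eq_complex /=; apply/andP; split; apply/eqP; ring.
  by rewrite exprMn -exprM mulnC exprM natrX.
rewrite [RHS]e4; congr gaussian; first by rewrite -re; ring.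
by rewrite -[RHS](mulr0 4) -im; ring.
Qed.

End GaussianIntegers.

(** * The character of the ring modulo 4 *)

Section ResidueRing.
Variable K : fieldExtType Q2.
Hypothesis hunr : unramified K.
Local Notation R := (RK K).
Local Notation pi_R := (\pi_R).

Lemma pi_RK_eq0 (x : OK K) : pi_R x = 0 -> exists y, x = 2 * (2 * y).
Proof.
rewrite -(rmorph0 \pi_R) => /eqP; rewrite -Quotient.idealrBE subr0 => /asboolP [y ->].
by exists y; rewrite mulrA -expr2.
Qed.

Lemma RK_4_eq0 (r : R) : 2 * (2 * r) = 0.
Proof.
rewrite -[r]reprK; move: (repr r) => x.
rewrite -(rmorph_nat \pi_R) -!rmorphM -(rmorph0 \pi_R); apply/eqP.
by rewrite -Quotient.idealrBE subr0; apply/asboolP; exists x; rewrite mulrA -expr2.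
Qed.

Lemma RK_double_eq0 (r : R) : 2 * r = 0 -> exists s, r = 2 * s.
Proof.
rewrite -[r]reprK; move: (repr r) => x.
rewrite -(rmorph_nat \pi_R) -rmorphM => /pi_RK_eq0 [y /OK_mul2I ->].
by exists (\pi_R y); rewrite rmorphM.
Qed.

(** The multiplier is taken in [O_K], and not in its quotient, because it also
    has to act on vectors over the residue field. *)
Lemma RK_unit (r : R) : 2 * r != 0 -> exists x : OK K, \pi_R x * r = 1.
Proof.
rewrite -[r]reprK; move: (repr r) => x.
have [[y xy]|[y ->]] := OK_unit_or_double hunr x.
  by exists y; rewrite -rmorphM mulrC xy rmorph1.
by rewrite rmorphM rmorph_nat RK_4_eq0 eqxx.
Qed.

Lemma trD : {morph @tr K : z w / z + w}.
Proof.
have [e [eB eS]] := exists_integral_basis hunr.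
move=> z w; rewrite -[z]reprK -[w]reprK -rmorphD !(tr_pi eB eS).
by rewrite (OKtraceD eB) z2_mod4D.
Qed.

Lemma exists_tr_double : exists u : R, tr (2 * u) = 2.
Proof.
have [e [eB eS]] := exists_integral_basis hunr.
have [u u1] := exists_odd_trace eB eS hunr.
exists (\pi_R u); rewrite -(rmorph_nat \pi_R) -rmorphM (tr_pi eB eS) (OKtrace_double eB).
have [t ->] := z2_odd u1.
have -> : 2 * (1 + 2 * t) = 2 + 2 ^+ 2 * t by rewrite mulrDr mulr1 expr2 mulrA.
by rewrite z2_mod4D /z2_mod4 z2_pow2M0 addr0 z2natE.
Qed.

Section Character.
Variable Rr : realType.
Local Notation psi := (@psi Rr K).

Lemma psiE z : psi z =
  nth 0 [:: gaussian Rr 1 0; gaussian Rr 0 1;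
            gaussian Rr (-1) 0; gaussian Rr 0 (-1)] (tr z).
Proof.
by rewrite /Defs.psi expi_quarter modn_small //; exact: (ltn_ord (tr z)).
Qed.

Lemma psiD z w : psi (z + w) = psi z * psi w.
Proof.
by rewrite !psiE trD /=; case: (tr z) => [[|[|[|[|m]]]] lm] //;
  case: (tr w) => [[|[|[|[|n]]]] ln] //=; rewrite gaussianM.
Qed.

Lemma psi0 : psi 0 = 1.
Proof.
have t0 : tr (0 : R) = 0 by apply: (addrI (tr (0 : R))); rewrite -trD !addr0.
by rewrite psiE t0.
Qed.

Lemma psi_gaussian z : exists a b,
  psi z = gaussian Rr a b /\ psi (- z) = gaussian Rr a (- b).
Proof.
have tN : tr (- z) = - tr z.
  apply: (addrI (tr z)); rewrite -trD !subrr.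
  by apply: (addrI (tr (0 : R))); rewrite -trD !addr0.
rewrite !psiE tN; case: (tr z) => [[|[|[|[|m]]]] lm] //=.
- by exists 1, 0; rewrite oppr0.
- by exists 0, 1.
- by exists (-1), 0; rewrite oppr0.
- by exists 0, (-1); rewrite opprK.
Qed.

(** The value of [psi] at [2 * u] is -1 when [u] has an odd trace. *)
Lemma exists_psi_double_neq1 : exists u : R, psi (2 * u) != 1.
Proof.
have [u tu] := exists_tr_double; exists u; rewrite psiE tu /=.
rewrite /gaussian eq_complex /= mulrNz negb_and; apply/orP; left.
by apply/eqP; lra.
Qed.

End Character.
End ResidueRing.

(** * The symplectic space over the residue field *)

Import VectorInternalTheory.

Section Cardinality.
Variables (K : fieldExtType Q2) (hunr : unramified K).
Local Notation k := (residue_field K).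

(** A set of representatives of the residue field, indexed by a type with
    [2 ^ \dim {:K}] elements. *)
Lemma residue_representatives : exists rep : {ffun 'I_(\dim {:K}) -> 'F_2} -> OK K,
  (forall f g, \pi_k (rep f) = \pi_k (rep g) -> f = g) /\
  (forall x, exists f, \pi_k x = \pi_k (rep f)).
Proof.
have [e [eB eS]] := exists_integral_basis hunr.
pose rep (f : {ffun 'I_(\dim {:K}) -> 'F_2}) := \sum_i e i *+ f i.
have repE f : \pi_k (rep f) = \sum_i \pi_k (e i) *+ f i.
  by rewrite raddf_sum; apply: eq_bigr => i _; rewrite raddfMn.
exists rep; split=> [f g fg|x].
  apply/ffunP => i.
  by rewrite -(rescoord_sum eB eS f) -repE fg repE (rescoord_sum eB eS).
exists [ffun i => rescoord eS i (\pi_k x)].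
rewrite {1}[\pi_k x](rescoord_expand eB eS) repE.
by apply: eq_bigr => i _; rewrite ffunE.
Qed.

Lemma card_reduction (Vt : vectType (RK K)) :
  finite_set [set: reduction Vt] /\
  #|` fset_set [set: reduction Vt]| = (2 ^ (\dim {:K} * dim Vt))%N.
Proof.
have [rep [rep_inj rep_surj]] := residue_representatives.
pose T := {ffun 'I_(dim Vt) -> {ffun 'I_(\dim {:K}) -> 'F_2}}.
pose lift (f : T) : Vt := r2v (\row_a \pi_(RK K) (rep (f a))).
pose g (f : T) : reduction Vt := \pi_(reduction Vt) (lift f).
have g_inj : injective g.
  move=> f1 f2 /red_eq_inv [u /(congr1 v2r)].
  rewrite linearB linearZ_LR /= !r2vK => /rowP fu.
  apply/ffunP => a; apply: rep_inj; have := fu a; rewrite !mxE.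
  rewrite -[v2r u 0 a]reprK -rmorphB -(rmorph_nat \pi_(RK K)) -rmorphM.
  move/eqP; rewrite -subr_eq0 -rmorphB => /eqP /pi_RK_eq0 [y xy].
  apply/eqP; rewrite -Quotient.idealrBE; apply/asboolP.
  exists (2 * y + repr (v2r u 0 a)).
  by rewrite expr1 mulrDr -xy subrK.
have gT : g @` [set: T] = [set: reduction Vt].
  apply/seteqP; split=> // v _; rewrite -[v]reprK; move: (repr v) => {}v.
  have /boolp.choice [f fP] a := rep_surj (repr (v2r v 0 a)).
  exists [ffun a => f a] => //; apply/esym/red_eqP.
  have /boolp.choice [y yP] a : exists y, repr (v2r v 0 a) - rep (f a) = 2 * y.
    have /eqP := fP a; rewrite -Quotient.idealrBE => /asboolP [y].
    by rewrite expr1; exists y.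
  exists (r2v (\row_a \pi_(RK K) (y a))); apply: (can_inj v2rK).
  rewrite linearB linearZ_LR /= !r2vK; apply/rowP => a; rewrite !mxE ffunE.
  by rewrite -[v2r v 0 a]reprK -rmorphB yP rmorphM rmorph_nat.
have Tf : finite_set [set: T] by exact: finite_finset.
split; first by rewrite -gT; apply: finite_image.
rewrite -gT fset_set_image // card_imfset //=.
have /perm_size -> : perm_eq (fset_set [set: T]) (enum T).
  apply: uniq_perm; rewrite ?fset_uniq ?enum_uniq // => f.
  by rewrite mem_enum in_fset_set // in_setT.
by rewrite -cardE !card_ffun !card_ord -expnM.
Qed.
End Cardinality.

Section Form.
Variables (K : fieldExtType Q2) (hunr : unramified K) (Vt : vectType (RK K)).
Variables (omt : {biscalar Vt}) (L0 M0 : set Vt).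
Hypotheses (hsymp : symplectic omt) (hsplit : lagrangian_splitting omt L0 M0).
Local Notation V := (reduction Vt).
Local Notation R := (RK K).
Local Notation omega := (omega omt).
Local Notation beta := (beta omt L0 M0).
Local Notation betat := (betat omt L0 M0).
Local Notation comp := (components L0 M0).

(** A representative of [\pi_V v] differs from [v] by a multiple of 2, and 4
    vanishes in [R]. *)
Lemma double_form_pi (f : Vt -> Vt -> RK K) (v w : Vt) :
    (forall z, {morph f^~ z : x y / x + y}) -> (forall z, {morph f z : x y / x + y}) ->
  2 * f (repr (\pi_V v)) (repr (\pi_V w)) = 2 * f v w.
Proof.
move=> fDl fDr.
have red (x : Vt) : exists u, repr (\pi_V x) = x + (u + u).
  have [u xu] : exists u, repr (\pi_V x) - x = 2 *: u.
    by apply: red_eq_inv; rewrite reprK.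
  by exists u; rewrite -mulr2n -scaler_nat -xu addrC subrK.
have [u ->] := red v; have [t ->] := red w.
have two x : 2 * (x + x) = 0 :> RK K.
  by rewrite -mulr2n -[x *+ 2]mulr_natl RK_4_eq0.
have rr x : 2 * f x (w + (t + t)) = 2 * f x w by rewrite !fDr mulrDr two addr0.
by rewrite rr !fDl mulrDr two addr0.
Qed.

Lemma omt_sym v w : omt v w = - omt w v.
Proof.
apply/eqP; rewrite -addr_eq0; apply/eqP.
have := hsymp.1 (v + w); rewrite linearDl !linearDr !hsymp.1 add0r addr0.
by move=> <-.
Qed.

Lemma componentsP v : [/\ L0 (comp v).1, M0 (comp v).2 & v = (comp v).1 + (comp v).2].
Proof.
rewrite /components; set P := (X in xget _ X).
have [_ _ _ _ /(_ v) [lm [Plm _]]] := hsplit.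
exact: (xgetI (0, 0) (Plm : P lm)).
Qed.

Lemma components_unique v l m : L0 l -> M0 m -> v = l + m -> comp v = (l, m).
Proof.
move=> Ll Mm vE; have [_ _ _ _ /(_ v) [lm [_ uniq]]] := hsplit.
by rewrite -(uniq _ (componentsP v)) (uniq (l, m)).
Qed.

Lemma submoduleD (W : lmodType R) (A : set W) v w :
  submodule A -> A v -> A w -> A (v + w).
Proof. by case=> _ H Av Aw; rewrite -[v]scale1r; apply: H. Qed.

Lemma componentsD v w : comp (v + w) = ((comp v).1 + (comp w).1, (comp v).2 + (comp w).2).
Proof.
have [[L0s _] [M0s _] _ _ _] := hsplit.
have [L1 M1 E1] := componentsP v; have [L2 M2 E2] := componentsP w.
apply: components_unique; [exact: submoduleD | exact: submoduleD |].
by rewrite {1}E1 {1}E2 addrACA.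
Qed.

Lemma betatDl w : {morph betat^~ w : u v / u + v}.
Proof. by move=> u v; rewrite /Defs.betat componentsD linearDl. Qed.
Lemma betatDr w : {morph betat w : u v / u + v}.
Proof. by move=> u v; rewrite /Defs.betat componentsD linearDr. Qed.

(** The two diagonal terms of the expansion of [omt v w] vanish because [L0]
    and [M0] are isotropic. *)
Lemma betat_antisym v w : betat v w - betat w v = omt v w.
Proof.
have [[_ L0l] [_ M0l] _ _ _] := hsplit.
have [L1 M1 E1] := componentsP v; have [L2 M2 E2] := componentsP w.
rewrite {3}E1 {3}E2 linearDl !linearDr.
rewrite ((L0l _).1 L1 _ L2) ((M0l _).1 M1 _ M2) add0r addr0.
by rewrite [omt (comp v).2 _]omt_sym.
Qed.

Lemma omega_pi v w : omega (\pi_V v) (\pi_V w) = 2 * omt v w.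
Proof. by apply: double_form_pi => z; [exact: linearDl | exact: linearDr]. Qed.

Lemma beta_pi v w : beta (\pi_V v) (\pi_V w) = 2 * betat v w.
Proof. by apply: double_form_pi => z; [exact: betatDl | exact: betatDr]. Qed.

Lemma pi_VD (v w : Vt) : \pi_V v + \pi_V w = \pi_V (v + w) :> V.
Proof. by rewrite -[LHS]raddfD. Qed.

Lemma omegaDl w : {morph omega^~ w : u v / u + v}.
Proof.
move=> u v; rewrite -[u]reprK -[v]reprK -[w]reprK pi_VD !omega_pi.
by rewrite linearDl mulrDr.
Qed.
Lemma omegaDr w : {morph omega w : u v / u + v}.
Proof.
move=> u v; rewrite -[u]reprK -[v]reprK -[w]reprK pi_VD !omega_pi.
by rewrite linearDr mulrDr.
Qed.
Lemma betaDl w : {morph beta^~ w : u v / u + v}.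
Proof.
move=> u v; rewrite -[u]reprK -[v]reprK -[w]reprK pi_VD !beta_pi.
by rewrite betatDl mulrDr.
Qed.
Lemma betaDr w : {morph beta w : u v / u + v}.
Proof.
move=> u v; rewrite -[u]reprK -[v]reprK -[w]reprK pi_VD !beta_pi.
by rewrite betatDr mulrDr.
Qed.

Lemma beta_antisym v w : beta v w - beta w v = omega v w.
Proof.
by rewrite -[v]reprK -[w]reprK !beta_pi omega_pi -mulrBr betat_antisym.
Qed.

Lemma omega_sym v w : omega v w = - omega w v.
Proof. by rewrite -!beta_antisym opprB. Qed.

Lemma omegaZl (x : OK K) v w :
  omega (\pi_(residue_field K) x *: v) w = \pi_R x * omega v w.
Proof.
rewrite -[v]reprK -[w]reprK [_ *: _]red_scaleE !omega_pi linearZl_LR.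
by rewrite mulrCA.
Qed.

(** If [2 * omt x w] vanishes for all [w] then [2 *: x = 0], so the coordinates
    of [x] are killed by 2, hence multiples of 2, since [Vt] is free over [R]. *)
Lemma omega_nondeg v : (forall w, omega v w = 0) -> v = 0.
Proof.
rewrite -[v]reprK; move: (repr v) => x ox.
have /hsymp.2 x2 : forall w, omt (2 *: x) w = 0.
  by move=> w; rewrite linearZl_LR -omega_pi ox.
suff [u ->] : exists u, x = 2 *: u.
  by rewrite -[0](raddf0 \pi_V); apply: red_eqP; exists u; rewrite subr0.
have := congr1 v2r x2; rewrite linearZ linear0 => /rowP x2r.
have /boolp.choice [u uP] i : exists s, v2r x 0 i = 2 * s.
  by apply: RK_double_eq0; have := x2r i; rewrite !mxE.
exists (r2v (\row_i u i)); apply: (can_inj v2rK); rewrite linearZ_LR /= r2vK.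
by apply/rowP => i; rewrite !mxE.
Qed.

End Form.

(** * Intertwiners of the Heisenberg group *)

(** Applied to the cardinalities of three Lagrangians in general position, two
    by two complementary. *)
Lemma pairwise_product_sqr (x y z q : nat) : (0 < q -> x * y = q ^ 2 -> y * z = q ^ 2 ->
  x * z = q ^ 2 -> y = q)%N.
Proof.
move=> q0 xy yz xz; apply/eqP; rewrite -eqn_sqr.
have q2 : (0 < q ^ 2)%N by rewrite expn_gt0 q0.
by rewrite -(eqn_pmul2r q2) -{1}xz -{1}xy -yz; apply/eqP; ring.
Qed.

Section Heisenberg.
Variables (Rr : realType) (K : fieldExtType Q2) (hunr : unramified K).
Variables (Vt : vectType (RK K)) (omt : {biscalar Vt}) (L0 M0 : set Vt).
Hypotheses (hsymp : symplectic omt) (hsplit : lagrangian_splitting omt L0 M0).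
Local Notation V := (reduction Vt).
Local Notation R := (RK K).
Local Notation omega := (omega omt).
Local Notation beta := (beta omt L0 M0).
Local Notation hmul := (hmul omt L0 M0).
Local Notation psi := (psi Rr).
Implicit Types (A B : elag omt L0 M0).

(** The central coordinate of the enhanced Lagrangian [A], seen as a section. *)
Definition height A v : R := (esec A v).2.

Let bDl := betaDl hsplit.
Let bDr := betaDr hsplit.

Lemma beta0l v : beta 0 v = 0.
Proof. by apply: (addrI (beta 0 v)); rewrite -bDl !addr0. Qed.

Lemma esecE A v : esupp A v -> esec A v = (v, height A v).
Proof. by move=> Av; rewrite [LHS]surjective_pairing (esec_section Av). Qed.

Lemma esuppD A v w : esupp A v -> esupp A w -> esupp A (v + w).
Proof.
by move=> Av Aw; have [[_ As] _] := esupp_lagrangian A; rewrite -[v]scale1r; apply: As.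
Qed.
Lemma esuppN A v : esupp A v -> esupp A (- v).
Proof.
move=> Av; have [[A0 As] _] := esupp_lagrangian A.
by rewrite -[- v]addr0 -scaleN1r; apply: As.
Qed.
Lemma esupp0 A : esupp A 0. Proof. by have [[]] := esupp_lagrangian A. Qed.
Lemma esupp_shift A a : esupp A a -> forall x, esupp A x <-> esupp A (a + x).
Proof.
move=> Aa x; split=> [|Aax]; first exact: esuppD.
by rewrite -(addKr a x); apply: esuppD => //; apply: esuppN.
Qed.

Lemma heightD A v w : esupp A v -> esupp A w ->
  height A (v + w) = height A v + height A w + beta v w.
Proof.
by move=> Av Aw; rewrite {1}/height esec_morph // !esecE.
Qed.
Lemma height0 A : height A 0 = 0.
Proof.
apply: (addrI (height A 0)); rewrite addr0 -{3}[0]addr0.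
by rewrite heightD ?beta0l ?addr0 //; exact: esupp0.
Qed.

Lemma esupp_isotropic A v w : esupp A v -> esupp A w -> omega v w = 0.
Proof.
by move=> Av; have [_ /(_ v) []] := esupp_lagrangian A => /(_ Av) H _; exact: H.
Qed.

(** A common vector of [A] and [B] is orthogonal to [A] and to [B], hence to
    their sum, which is everything. *)
Lemma general_position_trivial A B v : general_position A B ->
  esupp A v -> esupp B v -> v = 0.
Proof.
move=> AB Av Bv; apply: (omega_nondeg hsymp) => w.
have [a [b [Aa Bb ->]]] := AB w.
by rewrite (omegaDr _ v) (esupp_isotropic Av Aa) (esupp_isotropic Bv Bb) addr0.
Qed.

Lemma esupp_finite A : finite_set (esupp A).
Proof. exact: sub_finite_set (card_reduction hunr Vt).1. Qed.

Lemma card_general_position A B : general_position A B ->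
  (#|` fset_set (esupp A)| * #|` fset_set (esupp B)| =
   2 ^ (\dim {:K} * dim Vt))%N.
Proof.
move=> AB; have [_ <-] := card_reduction hunr Vt.
have fA := esupp_finite A; have fB := esupp_finite B.
pose add (p : V * V) := p.1 + p.2.
have add_bij : set_bij (esupp A `*` esupp B) [set: V] add.
  split=> // [[a b] [a' b'] /set_mem [/= Aa Bb] /set_mem [/= Aa' Bb'] e|v _]; last first.
    by have [a [b [Aa Bb ->]]] := AB v; exists (a, b).
  rewrite /add /= in e; have aa' : a = a'.
    apply/eqP; rewrite -subr_eq0; apply/eqP/(general_position_trivial AB).
      by apply: esuppD => //; apply: esuppN.
    have -> : a - a' = b' - b.
      by apply/eqP; rewrite subr_eq addrAC eq_sym subr_eq e addrC.
    by apply: esuppD => //; apply: esuppN.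
  by rewrite aa' in e *; move/addrI: e => ->.
by rewrite (card_set_bij fA fB _ add_bij) //; exact: (card_reduction hunr Vt).1.
Qed.

Section Triple.
Variables N M L : elag omt L0 M0.
Hypotheses (NM : general_position N M) (ML : general_position M L).
Hypothesis NL : general_position N L.

Definition Npart v : V := projT1 (cid (NL v)).
Definition Lpart v : V := projT1 (cid (projT2 (cid (NL v)))).

Lemma NpartP v : esupp N (Npart v).
Proof. by rewrite /Npart /Lpart; case: (projT2 (cid (projT2 (cid (NL v))))). Qed.
Lemma LpartP v : esupp L (Lpart v).
Proof. by rewrite /Npart /Lpart; case: (projT2 (cid (projT2 (cid (NL v))))). Qed.
Lemma partsE v : v = Npart v + Lpart v.
Proof. by rewrite /Npart /Lpart; case: (projT2 (cid (projT2 (cid (NL v))))). Qed.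

Lemma NpartD : {morph Npart : v w / v + w}.
Proof.
move=> v w; apply/eqP; rewrite -subr_eq0; apply/eqP/(general_position_trivial NL).
  by apply: esuppD; [|apply/esuppN/esuppD]; apply: NpartP.
have -> : Npart (v + w) - (Npart v + Npart w) = Lpart v + Lpart w - Lpart (v + w).
  apply/eqP; rewrite subr_eq addrAC eq_sym subr_eq -partsE addrC addrACA.
  by rewrite -!partsE.
by apply: esuppD; [apply: esuppD|apply/esuppN]; apply: LpartP.
Qed.

Lemma LpartD : {morph Lpart : v w / v + w}.
Proof.
move=> v w; apply: (addrI (Npart (v + w))).
by rewrite -partsE NpartD addrACA -!partsE.
Qed.

Lemma Npart0 : Npart 0 = 0.
Proof. by apply: (addrI (Npart 0)); rewrite -NpartD !addr0. Qed.
Lemma Lpart0 : Lpart 0 = 0.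
Proof. by apply: (addrI (Lpart 0)); rewrite -LpartD !addr0. Qed.

(** The central element by which the section over [M] differs from the product
    of the sections over [L] and [N], see [esec_chi]. *)
Definition chi m : R :=
  height M m - height L (Lpart m) - height N (Npart m) - beta (Lpart m) (Npart m).

Lemma hmulA : associative hmul.
Proof.
move=> [v x] [w y] [u z]; rewrite /Defs.hmul /= addrA; congr (_, _).
by rewrite bDl bDr; move: (beta w u) (beta v w) (beta v u) => b1 b2 b3; ring.
Qed.

Lemma esec_chi m : esupp M m ->
  esec M m = hmul (hmul (0, chi m) (esec L (Lpart m))) (esec N (Npart m)).
Proof.
move=> Mm; rewrite !esecE //; [|exact: NpartP|exact: LpartP].
rewrite /Defs.hmul /= add0r beta0l addr0 addrC -partsE; congr (_, _).
rewrite /chi; move: (height M m) (height L _) (height N _) (beta _ _) => a b c d.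
by ring.
Qed.

(** In the double sum, [esec_chi] turns the term of [m] and [n] into
    [psi (chi m)] times the term of [Npart m + n] in the intertwiner to [N],
    and the sum over [n] is invariant under the translation by [Npart m]. *)
Lemma intertwiner_comp (f : heis Vt -> Rr[i]) : Hspace L f ->
  intertwiner N (intertwiner M f) =
  (fun h => (\sum_(m \in esupp M) psi (chi m)) * intertwiner N f h).
Proof.
move=> fL; apply: funext => h; rewrite /intertwiner.
rewrite exchange_fsbig; [|exact: esupp_finite|exact: esupp_finite].
rewrite mulr_fsuml; apply: eq_fsbigr => m /set_mem Mm.
rewrite mulr_fsumr -[RHS](fsum_shift _ (esupp_shift (NpartP m))).
apply: eq_fsbigr => n /set_mem Nn.
rewrite esec_chi // -hmulA fL; last exact: LpartP.
by rewrite hmulA -esec_morph //; exact: NpartP.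
Qed.

(** The function supported on the preimage of [L] in the Heisenberg group: in
    the sum over [N] at the neutral element only the term of 0 survives, as [N]
    and [L] meet in 0.  Without such a function the proportionality constant
    would not be determined. *)
Lemma exists_nonzero_intertwiner : exists2 f : heis Vt -> Rr[i],
  Hspace L f & intertwiner N f (0, 0) = 1.
Proof.
pose f (h : heis Vt) : Rr[i] :=
  if `[< esupp L h.1 >] then psi (h.2 - height L h.1) else 0.
exists f.
  move=> z l [v x] Ll; rewrite /f esecE // /Defs.hmul /= add0r beta0l addr0.
  have -> : `[< esupp L (l + v) >] = `[< esupp L v >].
    by apply/asbool_equiv_eq; apply: iff_sym; exact: esupp_shift.
  case: asboolP => [Lv|_]; last by rewrite mulr0.
  rewrite heightD // -psiD //; congr (psi _).
  move: (height L l) (height L v) (beta l v) => a b c.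
  by ring.
rewrite /intertwiner (fsbigD1 0); [|exact: esupp_finite|exact: esupp0].
rewrite fsbig1 /= ?addr0 => [|n [Nn n0]].
  rewrite /f esecE; last exact: esupp0.
  rewrite /Defs.hmul /= addr0 beta0l height0 !addr0 height0 subrr (psi0 hunr).
  by case: asboolP => // -[]; exact: esupp0.
rewrite /f esecE // /Defs.hmul /= addr0; case: asboolP => // Ln.
by case: n0; apply: general_position_trivial NL Nn Ln.
Qed.

Lemma CconstE : Cconst Rr N M L = \sum_(m \in esupp M) psi (chi m).
Proof.
apply: xget_unique; first exact: intertwiner_comp.
have [f fL f1] := exists_nonzero_intertwiner.
move=> c /(_ f fL); rewrite intertwiner_comp // => /(congr1 (fun g => g (0, 0))).
by rewrite f1 !mulr1.
Qed.

(** After expansion into the components along [N] and [L] only the two mixed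
    terms of [beta] with opposite signs are left, and the antisymmetrization of
    [beta] is [omega]; the component of [y] along [L] is orthogonal to that of
    [z]. *)
Lemma chiD y z : esupp M y -> esupp M z ->
  chi (y + z) = chi y + chi z + omega y (Lpart z).
Proof.
move=> My Mz; rewrite /chi heightD // NpartD LpartD.
rewrite !heightD; try exact: NpartP; try exact: LpartP.
have -> : beta y z = beta (Npart y + Lpart y) (Npart z + Lpart z) by rewrite -!partsE.
have -> : omega y (Lpart z) = beta (Npart y) (Lpart z) - beta (Lpart z) (Npart y).
  rewrite beta_antisym // [in LHS](partsE y) omegaDl.
  by rewrite (esupp_isotropic (LpartP y) (LpartP z)) addr0.
rewrite !bDl !bDr.
move: (height M y) (height M z) (height L _) (height L _) (height N _) (height N _).
move: (beta _ _) (beta _ _) (beta _ _) (beta _ _) (beta _ _) (beta _ _).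
move=> b1 b2 b3 b4 b5 b6 a1 a2 a3 a4 a5 a6.
by ring.
Qed.

Lemma chi0 : chi 0 = 0.
Proof. by rewrite /chi Npart0 Lpart0 !height0 beta0l !subr0. Qed.

(** If [Lpart z] is orthogonal to [M], it lies in [M] and in [L], so it is 0 and
    [z] lies in [M] and in [N].  Otherwise some value of the form is a non-zero
    multiple of 2, and multiplying [a] by a scalar makes it any multiple of 2,
    in particular one on which [psi] is non-trivial. *)
Lemma psi_chi_nondeg z : esupp M z -> z <> 0 ->
  exists2 a, esupp M a & psi (omega a (Lpart z)) != 1.
Proof.
move=> Mz z0.
have [a [Ma az]] : exists a, esupp M a /\ omega a (Lpart z) != 0.
  apply: contrapT => /forallNP H; apply: z0.
  have ML0 : Lpart z = 0.
    apply: (general_position_trivial ML) (LpartP z).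
    have [_ ->] := esupp_lagrangian M => w Mw; rewrite (omega_sym hsymp hsplit).
    by apply/eqP; rewrite oppr_eq0; apply/negPn/negP => ne; apply: (H w).
  apply: (general_position_trivial NM) Mz; rewrite (partsE z) ML0 addr0; exact: NpartP.
have [u u1] := exists_psi_double_neq1 hunr Rr.
(* omega is twice a form with values in R *)
have [s az2] : exists s, omega a (Lpart z) = 2 * s by eexists.
rewrite az2 in az; have [x xs] := RK_unit hunr az.
exists (\pi_(residue_field K) (repr u * x) *: a).
  by have [[M00 Ms] _] := esupp_lagrangian M; rewrite -[_ *: a]addr0; apply: Ms.
by rewrite omegaZl az2 rmorphM mulrACA xs mulr1 /= reprK mulrC.
Qed.

Lemma Cconst_pow4 D : #|` fset_set (esupp M)| = (2 ^ D)%N ->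
  Cconst Rr N M L ^+ 4 = (-1) ^+ D * (2 ^ D)%:R ^+ 2.
Proof.
move=> cM; have fM := esupp_finite M.
have [a [b [G G']]] := sum_gaussian fM (fun m => psi_gaussian hunr Rr (chi m)).
rewrite CconstE; apply: (gaussian_pow4 G G'); rewrite -cM.
apply: (@gauss_sum_norm _ _ _ _ _ (fun y z => psi (omega y (Lpart z)))) => //.
- exact: esupp0.
- by move=> v; exact: esupp_shift.
- by rewrite chi0 psi0.
- move=> y z My Mz; rewrite chiD // -!psiD //; congr (psi _).
  move: (chi y) (chi z) (omega y _) => a1 b1 c1.
  by rewrite [LHS]addrC !addrA addNr add0r.
- by move=> z y y'; rewrite omegaDl psiD.
- move=> y; have -> : omega y (Lpart 0) = 0; last exact: psi0.
  by apply: (addrI (omega y 0)); rewrite Lpart0 -omegaDr !addr0.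
- exact: psi_chi_nondeg.
Qed.
End Triple.

End Heisenberg.

Theorem theorem4p2 (Rr : realType) (K : fieldExtType Q2) (d n : nat)
  (Vt : vectType (RK K)) (omt : {biscalar Vt}) (L0 M0 : set Vt)
  (N M L : elag omt L0 M0)
  (hdeg : \dim {:K} = d) (hunr : unramified K)
  (hrank : dim Vt = (2 * n)%N) (hsymp : symplectic omt)
  (hsplit : lagrangian_splitting omt L0 M0)
  (hU : U3 N M L) :
  Cconst Rr N M L ^+ 4 =
    (-1) ^+ (d * n) * #|` fset_set (esupp M)|%:R ^+ 2.
Proof.
have [NM ML NL] := hU.
have cM : #|` fset_set (esupp M)| = (2 ^ (d * n))%N.
  have qq : (2 ^ (\dim {:K} * dim Vt) = (2 ^ (d * n)) ^ 2)%N.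
    by rewrite hdeg hrank mulnCA mulnC expnM.
  apply: (@pairwise_product_sqr _ _ #|` fset_set (esupp L)|); first by rewrite expn_gt0.
  - by rewrite -qq; exact: card_general_position NM.
  - by rewrite -qq; exact: card_general_position ML.
  - by rewrite -qq; exact: card_general_position NL.
by rewrite (Cconst_pow4 Rr hunr hsymp hsplit NM ML NL cM) cM.
Qed.
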